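(* Let $A(x)=1+\sum_{n\ge1}a_nx^n$ and $B(x)=1+\sum_{n\ge1}b_nx^n$ be power series with real coefficients, with radii of convergence $R>0$ and $r>0$ respectively, satisfying the identity of formal power series $B(x)=A(xB(x))$. Assume that $a_n\ge0$ for all $n\ge1$ and that $\gcd(\{n\ge1:a_n>0\})=1$. If it is not the case that $b_nr^n=\Theta(n^{-3/2})$ as $n\to\infty$, then $R=rB(r)$.
   Context: The coefficients $b_n$ are non-negative under these hypotheses, and $B(r)=\sum_{n\ge0}b_nr^n\in(0,\infty]$ (with $b_0=1$). Radii of convergence take values in $[0,\infty]$, and the equality $R=rB(r)$ is understood in $[0,\infty]$. $u_n=\Theta(v_n)$ means that there are constants $0<c\le c'$ with $c\,v_n\le u_n\le c'v_n$ for all sufficiently large $n$. *)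

(* Defs.v *)
From HB Require Import structures.
From mathcomp Require Import all_boot all_order all_algebra.
From mathcomp Require Import all_classical all_reals all_analysis.

Set Implicit Arguments.
Unset Strict Implicit.
Unset Printing Implicit Defensive.

Import Order.TTheory GRing.Theory Num.Theory.
Import numFieldNormedType.Exports.

Local Open Scope classical_set_scope.
Local Open Scope ring_scope.

(* A formal power series is the sequence of its coefficients. *)

Definition fps_one (R : pzSemiRingType) : nat -> R := fun n => (n == 0%N)%:R.

Definition fps_X (R : pzSemiRingType) : nat -> R := fun n => (n == 1%N)%:R.

Definition fps_mul (R : pzSemiRingType) (u v : nat -> R) : nat -> R :=
  fun n => \sum_(k < n.+1) u k * v (n - k)%N.

Definition fps_exp (R : pzSemiRingType) (u : nat -> R) (k : nat) : nat -> R :=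
  iter k (fps_mul u) (fps_one R).

(* The composite A(G(x)) of formal power series, for G with G(0) = 0: the
   coefficient of x^n in sum_k a_k G(x)^k only involves the k <= n, because of
   [fps_exp_low] below. *)
Definition fps_comp (R : pzSemiRingType) (a g : nat -> R) : nat -> R :=
  fun n => \sum_(k < n.+1) a k * fps_exp g k n.

Lemma fps_exp_low (R : pzSemiRingType) (g : nat -> R) (k n : nat) :
  g 0%N = 0 -> (n < k)%N -> fps_exp g k n = 0.
Proof.
move=> g0; elim: k n => [//|k IHk] [|n] nk.
  by rewrite /fps_exp iterS /fps_mul big_ord1 g0 mul0r.
have nk' : (n < k)%N by [].
rewrite /fps_exp iterS -/(fps_exp g k) /fps_mul big1 // => -[[|i] ilt] _ /=.
  by rewrite g0 mul0r.
rewrite IHk ?mulr0 // subSS.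
exact: leq_ltn_trans (leq_subr i n) nk'.
Qed.

(* Valued in [0, +oo]; the set contains 0 since the series converges at 0. *)
Definition conv_radius (R : realType) (a : nat -> R) : \bar R :=
  ereal_sup [set `|x|%:E | x in [set x : R | cvgn (pseries a x)]].

(* d is the gcd of a possibly infinite set of natural numbers; the empty set
   has gcd 0. *)
Definition is_gcd_set (S : set nat) (d : nat) : Prop :=
  (forall n, S n -> (d %| n)%N) /\
  (forall e : nat, (forall n, S n -> (e %| n)%N) -> (e %| d)%N).

Definition is_Theta (R : realType) (u v : nat -> \bar R) : Prop :=
  exists c c' : R, [/\ 0 < c, c <= c' &
    \forall n \near \oo, (c%:E * v n <= u n)%E /\ (u n <= c'%:E * v n)%E].

(* Main.v *)
Require Import Defs.
From HB Require Import structures.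
From mathcomp Require Import all_boot all_order all_algebra.
From mathcomp Require Import all_classical all_reals all_analysis.
From mathcomp Require Import ring lra zify.

Set Implicit Arguments.
Unset Strict Implicit.
Unset Printing Implicit Defensive.

Import Order.TTheory GRing.Theory Num.Theory.
Import numFieldNormedType.Exports.

Local Open Scope classical_set_scope.
Local Open Scope ring_scope.


(** Why the theorem holds. The series G(z) = z B(z) solves G = z A(G), the
equation of simply generated trees, and b_n r^n is of order n^(-3/2) as soon
as the point t = r B(r) lies strictly inside the disc of convergence of A.
The proof assumes R <> r B(r) and derives that order.

Position of t. For nonnegative coefficients the functional equation can be
read on partial sums ([inverse_partial_sum_le], [outer_partial_sum_le]), and
two facts follow. Where B converges, A converges at z B(z) with
A(z B(z)) <= B(z); hence r B(r) <= R. Conversely, if z A(x) <= x for some x at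
which A converges, then B converges at z; hence x <= r A(x) for 0 < x < R.
So if r B(r) <> R, then r and t are finite, t < R, and t minimises
r A(x) - x over ]0, R[ with minimum value 0 ([critical_point]). The derivative
vanishes there: r A'(t) = 1.

Probabilistic form. With p_k = (r / t) a_k t^k, the relations r A(t) = t and
r A'(t) = 1 say that p is a probability distribution of mean 1; it has a
finite second moment because t < R. Lagrange inversion
([lagrange_inversion]) gives (n + 1) b_n = [x^n] A(x)^(n+1), hence
  b_n r^n = (t / r) P(S_(n+1) = n) / (n + 1),
where S_N is the sum of N independent variables of law p. It remains to show
that P(S_N = N - 1) is of order N^(-1/2) ([local_limit_bounds]).

Local estimate. Because p_0 > 0 and the support has gcd 1, some power p^m of
the law (for convolution) charges three consecutive integers, so it dominates
eps times the law of q plus the number of heads in two fair coin tosses.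
Expanding the M-th power of this decomposition, S_N becomes a mixture, over
the number k of factors taken from the coins, of an arbitrary variable plus
k q plus a binomial variable with 2k trials ([mixture_expansion]), and k is
itself binomial with mean of order N. The point probabilities of that
binomial variable are at most 1 / sqrt (k + 1), and of order 1 / sqrt k within
O(sqrt k) of the centre ([two_coins_exp_upper], [two_coins_exp_lower]).
The expectation of 1 / (k + 1) is O(1 / N), which gives the upper bound, and
which with Markov's inequality makes small k unlikely; Chebyshev's inequality
keeps the rest of the sum within O(sqrt N) of its mean, which gives the lower
bound.

Only p_0, ..., p_n matter for the coefficient of x^n, so all the sums of
independent variables are powers of truncated polynomials; the
second moment of p makes the mass lost by truncation O(1 / n^2) and the error
on the mean O(1 / n), which are negligible. *)

(** * Lagrange inversion *)

(** Coefficients up to a fixed degree are unaffected by truncation, so the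
formal identities reduce to identities between polynomials. *)
Lemma fps_exp_coef (A : nzRingType) (u : nat -> A) (k n N : nat) :
  (n < N)%N -> fps_exp u k n = ((\poly_(i < N) u i) ^+ k)`_n.
Proof.
elim: k n => [|k IHk] n nN; first by rewrite expr0 coef1.
rewrite /fps_exp iterS -/(fps_exp u k) exprS coefM; apply: eq_bigr => i _.
have iN : (i < N)%N by rewrite (leq_ltn_trans _ nN) // -ltnS.
by rewrite coef_poly iN IHk // (leq_ltn_trans (leq_subr _ _) nN).
Qed.

Lemma fps_mulX_poly (A : nzRingType) (u : nat -> A) (N : nat) :
  \poly_(i < N.+1) fps_mul (fps_X A) u i = 'X * \poly_(i < N) u i.
Proof.
apply/polyP => -[|n]; rewrite coefXM coef_poly /=.
  by rewrite /fps_mul big_ord1 /fps_X mul0r.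
rewrite ltnS coef_poly; case: ifP => // _.
rewrite /fps_mul 2!big_ord_recl /fps_X /= mul0r add0r mul1r subn1 /=.
by rewrite big1 ?addr0 // => i _; rewrite mul0r.
Qed.

(** The factor X makes the sum finite with a bound depending on n alone. *)
Lemma coef_comp_polyXM (A : comNzRingType) (U V : {poly A}) (n : nat) :
  (U \Po ('X * V))`_n = \sum_(j < n.+1) U`_j * (V ^+ j)`_(n - j).
Proof.
pose L := (n.+1 + size U)%N.
have -> : U \Po ('X * V) = \sum_(j < L) U`_j *: ('X * V) ^+ j.
  rewrite comp_polyE (big_ord_widen L (fun j => U`_j *: ('X * V) ^+ j));
    last by rewrite leq_addl.
  rewrite big_mkcond; apply: eq_bigr => j _; case: ltnP => // Uj.
  by rewrite nth_default // scale0r.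
rewrite coef_sum (big_ord_widen L (fun j => U`_j * (V ^+ j)`_(n - j)));
  last by rewrite leq_addr.
rewrite [RHS]big_mkcond; apply: eq_bigr => j _.
by rewrite coefZ exprMn coefXnM ltnS ltnNge; case: leqP; rewrite ?mulr0.
Qed.

Lemma coef_exp_congr (A : nzRingType) (U V : {poly A}) (N k n : nat) :
  (forall i, (i <= N)%N -> U`_i = V`_i) -> (n <= N)%N ->
  (U ^+ k)`_n = (V ^+ k)`_n.
Proof.
move=> UV; elim: k n => [//|k IHk] n nN.
rewrite !exprS !coefM; apply: eq_bigr => i _; rewrite UV ?IHk //.
  exact: leq_trans (leq_subr _ _) nN.
by rewrite (leq_trans _ nN) // -ltnS.
Qed.

(** Both sides are the coefficient of x^m in k (n + k) x P' P^(n + k - 1). *)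
Lemma coef_mulX_deriv_exp (A : comNzRingType) (P : {poly A}) (n k m : nat) :
  (n + k)%:R * (\sum_(j < m.+1) j%:R * (P ^+ k)`_j * (P ^+ n)`_(m - j)) =
  k%:R * m%:R * (P ^+ (n + k))`_m.
Proof.
have XD (U : {poly A}) j : ('X * U^`())`_j = j%:R * U`_j.
  by rewrite coefXM coef_deriv; case: j => [|j] /=; rewrite ?mul0r ?mulr_natl.
have -> : \sum_(j < m.+1) j%:R * (P ^+ k)`_j * (P ^+ n)`_(m - j) =
          ('X * (P ^+ k)^`() * P ^+ n)`_m.
  by rewrite coefM; apply: eq_bigr => j _; rewrite XD.
rewrite -[RHS]mulrA -XD !mulr_natl -!coefMn; congr (_`_m).
rewrite !deriv_exp; case: k => [|k]; first by rewrite !mulr0n mulr0 mul0r mul0rn.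
rewrite addnS /= exprD !mulrnAr !mulrnAl -!mulrnA mulnC -!mulrA.
by rewrite [P ^+ n * _]mulrC.
Qed.

(** From Q = P(X Q) one gets Q^k = P^k(X Q), that is, the recursion
[x^n] Q^k = sum over j of [x^j] P^k times [x^(n-j)] Q^j. It determines the
numbers [x^n] Q^k by induction on n, and by the previous lemma the values
k / (n + k) [x^n] P^(n + k) satisfy it as well. *)
Lemma lagrange_inversion_poly (K : numFieldType) (P Q : {poly K}) (N : nat) :
  (forall n, (n <= N)%N -> Q`_n = (P \Po ('X * Q))`_n) ->
  forall n k, (n <= N)%N ->
    (n + k)%:R * (Q ^+ k)`_n = k%:R * (P ^+ (n + k))`_n.
Proof.
move=> QE n; have [m] := ubnP n; elim: m n => // m IHm n nm k nN.
have recQ : (Q ^+ k)`_n = \sum_(j < n.+1) (P ^+ k)`_j * (Q ^+ j)`_(n - j).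
  by rewrite (coef_exp_congr k QE nN) -rmorphXn coef_comp_polyXM.
case: n nm nN recQ => [|n] nm nN recQ.
  by rewrite recQ big_ord1 subnn expr0 coefC mulr1.
have n0 : n.+1%:R != 0 :> K by rewrite pnatr_eq0.
apply: (mulfI n0); rewrite mulrCA [RHS]mulrA [n.+1%:R * k%:R]mulrC.
rewrite -coef_mulX_deriv_exp; congr (_ * _).
rewrite recQ mulr_sumr; apply: eq_bigr => -[[|j] jn] _ /=.
  by rewrite expr0 coefC subn0 mul0r mul0r mulr0 mulr0.
have := IHm (n.+1 - j.+1)%N _ j.+1 _; rewrite subnK // => IH.
rewrite mulrCA IH; last 2 first.
- by rewrite subSS (leq_ltn_trans (leq_subr _ _)).
- by rewrite subSS (leq_trans (leq_subr _ _)) // ltnW.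
by rewrite mulrA [_ * j.+1%:R]mulrC.
Qed.

(** The truncation orders M and N are independent: Lagrange inversion and the
inequalities on partial sums use different pairs. *)
Lemma fps_comp_mulX_poly (A : comNzRingType) (a b : nat -> A) (n M N : nat) :
  (n < M)%N -> (n <= N)%N ->
  fps_comp a (fps_mul (fps_X A) b) n =
  (\poly_(i < M) a i \Po ('X * \poly_(i < N) b i))`_n.
Proof.
move=> nM nN; rewrite coef_comp_polyXM.
apply: eq_bigr => -[j /= jn] _.
rewrite (@fps_exp_coef _ _ _ _ N.+1) ?ltnS //.
rewrite fps_mulX_poly exprMn coefXnM ltnNge -ltnS jn /=.
by rewrite coef_poly (leq_ltn_trans _ nM) // -ltnS.
Qed.

Lemma lagrange_inversion (K : numFieldType) (a b : nat -> K) :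
  (forall n, b n = fps_comp a (fps_mul (fps_X K) b) n) ->
  forall n, n.+1%:R * b n = fps_exp a n.+1 n.
Proof.
move=> bE n.
pose P := \poly_(i < n.+1) a i; pose Q := \poly_(i < n.+1) b i.
have QE m : (m <= n)%N -> Q`_m = (P \Po ('X * Q))`_m.
  by move=> mn; rewrite coef_poly ltnS mn bE -fps_comp_mulX_poly // leqW.
have := lagrange_inversion_poly QE 1 (leqnn n).
by rewrite addn1 expr1 coef_poly ltnSn mul1r (@fps_exp_coef _ _ _ _ n.+1).
Qed.

(** * Functional equation and nonnegative partial sums *)

Definition nneg_coef (K : numDomainType) (U : {poly K}) := forall i, 0 <= U`_i.

Lemma nneg_coef_poly (K : numDomainType) (u : nat -> K) (N : nat) :
  (forall i, 0 <= u i) -> nneg_coef (\poly_(i < N) u i).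
Proof. by move=> u0 i; rewrite coef_poly; case: ifP. Qed.

Lemma nneg_coefM (K : numDomainType) (U V : {poly K}) :
  nneg_coef U -> nneg_coef V -> nneg_coef (U * V).
Proof. by move=> U0 V0 i; rewrite coefM sumr_ge0 // => j _; rewrite mulr_ge0. Qed.

Lemma nneg_coef_exp (K : numDomainType) (U : {poly K}) (k : nat) :
  nneg_coef U -> nneg_coef (U ^+ k).
Proof.
move=> U0; elim: k => [|k IHk]; last by rewrite exprS; exact: nneg_coefM.
by move=> i; rewrite coef1 ler0n.
Qed.

Lemma nneg_coef_comp_XM (K : numDomainType) (U V : {poly K}) :
  nneg_coef U -> nneg_coef V -> nneg_coef (U \Po ('X * V)).
Proof.
move=> U0 V0 i; rewrite coef_comp_polyXM sumr_ge0 // => j _.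
by rewrite mulr_ge0 // nneg_coef_exp.
Qed.

Lemma horner_nneg_ge0 (K : numDomainType) (U : {poly K}) (z : K) :
  nneg_coef U -> 0 <= z -> 0 <= U.[z].
Proof.
move=> U0 z0; rewrite horner_coef sumr_ge0 // => i _.
by rewrite mulr_ge0 ?exprn_ge0.
Qed.

Lemma sum_coef_le_horner (K : numDomainType) (U : {poly K}) (z : K) (N : nat) :
  nneg_coef U -> 0 <= z ->
  \sum_(i < N) U`_i * z ^+ i <= U.[z].
Proof.
move=> U0 z0; have term0 i : 0 <= U`_i * z ^+ i.
  by rewrite mulr_ge0 ?exprn_ge0.
rewrite (horner_coef_wide _ (leq_addl N (size U))).
rewrite (big_ord_widen (N + size U) (fun i => U`_i * z ^+ i)) ?leq_addr //.
rewrite big_mkcond; apply: ler_sum => i _.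
by case: ifP => _; rewrite ?lexx ?term0.
Qed.

Lemma horner_nneg_le (K : numDomainType) (U : {poly K}) (y z : K) :
  nneg_coef U -> 0 <= y -> y <= z -> U.[y] <= U.[z].
Proof.
move=> U0 y0 yz; rewrite !horner_coef; apply: ler_sum => i _.
by rewrite ler_wpM2l // lerXn2r ?nnegrE // (le_trans y0).
Qed.

Lemma coef_exp_le (K : numDomainType) (U V : {poly K}) (k i : nat) :
  nneg_coef U -> (forall j, U`_j <= V`_j) ->
  (U ^+ k)`_i <= (V ^+ k)`_i.
Proof.
move=> U0 UV; elim: k i => [//|k IHk] i.
rewrite !exprS !coefM; apply: ler_sum => j _.
by apply: ler_pM => //; exact: nneg_coef_exp.
Qed.

Section Functional_equation.
Variables (K : realFieldType) (a b : nat -> K).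
Hypothesis a_ge0 : forall n, 0 <= a n.
Hypothesis bE : forall n, b n = fps_comp a (fps_mul (fps_X K) b) n.

(** The coefficient b_n is a polynomial with nonnegative coefficients in
a_0, ..., a_n and b_0, ..., b_(n-1). *)
Lemma inverse_coef_ge0 n : 0 <= b n.
Proof.
have [m] := ubnP n; elim: m n => // m IHm n nm.
rewrite bE (fps_comp_mulX_poly _ _ (ltnSn n) (leqnn n)).
apply: nneg_coef_comp_XM; first exact: nneg_coef_poly.
move=> i; rewrite coef_poly.
by case: ifP => // i_n; apply: IHm; rewrite (leq_trans i_n) // -ltnS.
Qed.

Let poly_ab M N : nneg_coef (\poly_(i < M) a i \Po ('X * \poly_(i < N) b i)).
Proof.
by apply: nneg_coef_comp_XM; apply: nneg_coef_poly; last exact: inverse_coef_ge0.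
Qed.

(** A supersolution t of G = z A(G) bounds the iterates that start from 0, and
these dominate the partial sums of z B(z). *)
Lemma inverse_partial_sum_le (z t : K) : 0 <= z -> 0 <= t ->
  (forall N, z * (\poly_(i < N) a i).[t] <= t) ->
  forall N, z * (\poly_(i < N) b i).[z] <= t.
Proof.
move=> z0 t0 zA; elim=> [|N IHN]; first by rewrite poly_def big_ord0 horner0 mulr0.
apply: le_trans (zA N.+1); rewrite ler_wpM2l //.
apply: le_trans (horner_nneg_le _ _ IHN); last 2 first.
- exact: nneg_coef_poly.
- rewrite mulr_ge0 // horner_nneg_ge0 //.
  exact/nneg_coef_poly/inverse_coef_ge0.
have -> : z * (\poly_(i < N) b i).[z] = ('X * \poly_(i < N) b i).[z].
  by rewrite hornerM hornerX.
rewrite -horner_comp; apply: le_trans (sum_coef_le_horner N.+1 (poly_ab _ _) z0).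
rewrite horner_poly; apply: ler_sum => -[i /= iN] _.
by rewrite {1}bE (@fps_comp_mulX_poly _ _ _ _ N.+1 N).
Qed.

(** The polynomial obtained by composing truncations of A and X B has
coefficients bounded by those of A(X B) = B. *)
Lemma outer_partial_sum_le (z s : K) : 0 <= z ->
  (forall N, (\poly_(i < N) b i).[z] <= s) ->
  forall M N, (\poly_(i < M) a i).[z * (\poly_(i < N) b i).[z]] <= s.
Proof.
move=> z0 bs M N.
have -> : z * (\poly_(i < N) b i).[z] = ('X * \poly_(i < N) b i).[z].
  by rewrite hornerM hornerX.
rewrite -horner_comp; set U := _ \Po _.
apply: le_trans (bs (size U)); rewrite horner_coef horner_poly.
apply: ler_sum => -[i /= iU] _; rewrite ler_wpM2r ?exprn_ge0 //.
rewrite bE (fps_comp_mulX_poly a b (leq_addl M i.+1) (leq_addl N i)).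
rewrite !coef_comp_polyXM; apply: ler_sum => -[j /= ji] _.
have b0 := inverse_coef_ge0.
apply: ler_pM.
- exact: nneg_coef_poly.
- exact/nneg_coef_exp/nneg_coef_poly.
- rewrite !coef_poly; case: ifP => jM; last by case: ifP.
  by rewrite (leq_trans jM) // leq_addr.
apply: coef_exp_le; first exact: nneg_coef_poly.
move=> k; rewrite !coef_poly; case: ifP => kN; last by case: ifP.
by rewrite (leq_trans kN) // leq_addr.
Qed.

End Functional_equation.

(** * The critical point *)

Section Nonneg_series.
Variables (K : realType) (u : nat -> K).
Hypothesis u_ge0 : forall n, 0 <= u n.

Lemma nneg_series_cvg (s : K) : (forall N, \sum_(i < N) u i <= s) ->
  cvgn (series u) /\ limn (series u) <= s.
Proof.
move=> us; have cu : cvgn (series u).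
  apply: nondecreasing_is_cvgn; first exact: nondecreasing_series.
  by exists s => _ [N _ <-]; rewrite seriesEord; exact: us.
by split=> //; apply: limr_le => //; near=> N; rewrite seriesEord; exact: us.
Unshelve. all: by end_near. Qed.

Lemma nneg_sum_le_lim (N : nat) : cvgn (series u) ->
  \sum_(i < N) u i <= limn (series u).
Proof.
move=> cu; rewrite -[leLHS](big_mkord xpredT).
apply: (@nondecreasing_cvgn_le _ (series u)) => //.
exact: nondecreasing_series.
Qed.

End Nonneg_series.

Lemma cvg_pseries_lt_radius (K : realType) (a : nat -> K) (x : K) :
  0 <= x -> (x%:E < conv_radius a)%E -> cvgn (pseries a x).
Proof.
move=> x0 /ereal_sup_gt[_ [y ay <-]]; rewrite lte_fin => xy.
by apply: is_cvg_pseries_inside ay _; rewrite ger0_norm.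
Qed.

Lemma cvg_pseries_le_radius (K : realType) (a : nat -> K) (x : K) :
  cvgn (pseries a x) -> (x%:E <= conv_radius a)%E.
Proof.
move=> ax; apply: (@le_trans _ _ `|x|%:E); first by rewrite lee_fin ler_norm.
by apply: ereal_sup_ubound; exists x.
Qed.

Lemma horner_poly_cvg (K : realType) (a : nat -> K) (x : K) :
  cvgn (pseries a x) -> (\poly_(i < N) a i).[x] @[N --> \oo] --> limn (pseries a x).
Proof.
move=> ax; apply: cvg_trans ax; apply: near_eq_cvg; near=> N.
by rewrite /pseries seriesEord /= horner_poly.
Unshelve. all: by end_near. Qed.

Section Critical_point.
Variables (K : realType) (a b : nat -> K).
Hypothesis a_ge0 : forall n, 0 <= a n.
Hypothesis a0E : a 0%N = 1.
Hypothesis b0E : b 0%N = 1.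
Hypothesis bE : forall n, b n = fps_comp a (fps_mul (fps_X K) b) n.

Let b_ge0 := inverse_coef_ge0 a_ge0 bE.

Let term_ge0 (u : nat -> K) x : (forall n, 0 <= u n) -> 0 <= x ->
  forall n, 0 <= u n * x ^+ n.
Proof. by move=> u0 x0 n; rewrite mulr_ge0 ?exprn_ge0. Qed.

(** A supersolution of G = z A(G) at which A converges forces B to converge
at z. As it holds on both sides of the critical point, it locates that point
without any study of the singularities of B. *)
Lemma le_inverse_radius (z t : K) : 0 <= z -> 0 <= t -> cvgn (pseries a t) ->
  z * limn (pseries a t) <= t -> (z%:E <= conv_radius b)%E.
Proof.
move=> z0 t0 ca zA; apply: cvg_pseries_le_radius.
(* At z = 0 every power series converges; the bound t / z needs z > 0. *)
have [->|z_neq0] := eqVneq z 0.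
  apply/cvg_ex; exists (b 0%N); apply: (@cvg_near_cst _ _ _ _ _).
  exists 1%N => // -[//|N] _ /=; rewrite /pseries seriesEord /= big_ord_recl.
  by rewrite expr0 mulr1 big1 ?addr0 // => i _; rewrite exprS mul0r mulr0.
have {z_neq0}z_gt0 : 0 < z by rewrite lt_def z_neq0.
have [] // := @nneg_series_cvg K _ (term_ge0 b_ge0 z0) (t / z).
move=> N; rewrite ler_pdivlMr // mulrC -horner_poly.
apply: (inverse_partial_sum_le a_ge0 bE z0 t0) => M.
apply: le_trans zA; rewrite ler_wpM2l // horner_poly.
exact: nneg_sum_le_lim (term_ge0 a_ge0 t0) _ ca.
Qed.

(** Polynomials are continuous, so the bound on pairs of partial sums passes to
the limit, first in the inner series and then in the outer one. *)
Lemma outer_at_inverse (z : K) : 0 <= z -> cvgn (pseries b z) ->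
  let t := z * limn (pseries b z) in
  cvgn (pseries a t) /\ limn (pseries a t) <= limn (pseries b z).
Proof.
move=> z0 cb t.
have bz N : (\poly_(i < N) b i).[z] <= limn (pseries b z).
  by rewrite horner_poly; exact: nneg_sum_le_lim (term_ge0 b_ge0 z0) _ cb.
have t0 : 0 <= t.
  by rewrite mulr_ge0 // (le_trans _ (bz 0%N)) // poly_def big_ord0 horner0.
apply: nneg_series_cvg; first exact: term_ge0.
move=> M; rewrite -horner_poly.
have lim_t : (\poly_(i < M) a i).[z * (\poly_(i < N) b i).[z]] @[N --> \oo]
    --> (\poly_(i < M) a i).[t].
  apply: continuous_cvg; first exact: continuous_horner.
  by apply: cvgMl_tmp; exact: horner_poly_cvg.
rewrite -(cvg_lim _ lim_t) //; apply: limr_le; first exact: cvgP lim_t.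
near=> N; exact: (outer_partial_sum_le a_ge0 bE).
Unshelve. all: by end_near. Qed.

Let inverse_sum_ge1 (x : K) : 0 <= x -> cvgn (pseries b x) ->
  1 <= limn (pseries b x).
Proof.
move=> x0 cb; apply: le_trans (nneg_sum_le_lim (term_ge0 b_ge0 x0) 1 cb).
by rewrite big_ord1 b0E mulr1.
Qed.

(** The bound z B(z) <= R is clear for z < r and passes to the limit on each
partial sum, whether or not B converges at r. If r is infinite, z <= z B(z)
forces R to be infinite too. *)
Lemma radius_mul_inverse_le (r : \bar K) :
  r = conv_radius b -> (0 < r)%E ->
  (r * \sum_(0 <= n <oo) (b n)%:E * r ^+ n <= conv_radius a)%E.
Proof.
move=> rE r_gt0.
have zR (z : K) N : 0 <= z -> (z%:E < r)%E ->
    ((z * (\poly_(i < N) b i).[z])%:E <= conv_radius a)%E.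
  move=> z0 zr; have cb : cvgn (pseries b z).
    by apply: cvg_pseries_lt_radius; rewrite // -rE.
  have [ca _] := outer_at_inverse z0 cb.
  apply: le_trans (cvg_pseries_le_radius ca).
  rewrite lee_fin ler_wpM2l // horner_poly.
  exact: nneg_sum_le_lim (term_ge0 b_ge0 z0) _ cb.
case: r rE r_gt0 zR => [r0| |] // rE r_gt0 zR.
- rewrite -nneseriesZl; last first.
    by move=> n _; rewrite -EFin_expe -EFinM lee_fin term_ge0 // ltW.
  apply: lime_le.
    apply: is_cvg_nneseries => n _ _.
    by rewrite -EFin_expe -!EFinM lee_fin mulr_ge0 ?term_ge0 // ltW.
  near=> N; rewrite (_ : (\sum_(0 <= n < N) _)%E =
      ((\poly_(i < N) b i * 'X).[r0])%:E); last first.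
    rewrite big_mkord hornerM hornerX horner_poly mulrC mulr_sumr -sumEFin.
    by apply: eq_bigr => n _; rewrite !EFinM EFin_expe.
  have pR z : 0 <= z -> z < r0 ->
      (((\poly_(i < N) b i * 'X).[z])%:E <= conv_radius a)%E.
    by move=> z0 zr; rewrite hornerM hornerX mulrC zR.
  case: (conv_radius a) pR => [R0| |] pR; last 2 first.
  + by rewrite leey.
  + by have := pR 0 (lexx _) r_gt0.
  have cvgp := cvg_at_left_filter (@continuous_horner K (\poly_(i < N) b i * 'X) r0).
  rewrite lee_fin -(cvg_lim _ cvgp) //.
  apply: limr_le; first exact: cvgP cvgp.
  near=> z; rewrite -lee_fin; apply: pR; last by near: z; exact: nbhs_left_lt.
  by near: z; exact: nbhs_left_ge.
- suff -> : conv_radius a = +oo%E by rewrite leey.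
  apply/eqyP => x x0; have := zR x 1%N (ltW x0) (ltry _).
  by rewrite horner_poly big_ord1 b0E mulr1 mulr1.
Unshelve. all: by end_near. Qed.

(** The point t is r B(r). For 0 < x < R, x / A(x) never
exceeds r, and it equals r at t: the smooth inversion x = z A(x) therefore has
a vertical tangent there. *)
Lemma critical_point (r : \bar K) :
  r = conv_radius b -> (0 < r)%E ->
  conv_radius a <> (r * \sum_(0 <= n <oo) (b n)%:E * r ^+ n)%E ->
  exists r0 t : K, [/\ r = r0%:E, 0 < r0, 0 < t, (t%:E < conv_radius a)%E &
    r0 * limn (pseries a t) = t /\
    forall x, 0 < x -> (x%:E < conv_radius a)%E ->
      x <= r0 * limn (pseries a x)].
Proof.
move=> rE r_gt0 neq.
have : (r * \sum_(0 <= n <oo) (b n)%:E * r ^+ n < conv_radius a)%E.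
  by rewrite lt_neqAle radius_mul_inverse_le // andbT; apply/eqP => /esym.
case: r rE r_gt0 {neq} => [r0| |] // rE r_gt0; last first.
  have S_gt0 : (0 < \sum_(0 <= n <oo) (b n)%:E * +oo ^+ n :> \bar K)%E.
    apply: (@lt_le_trans _ _ 1%E); first exact: lte01.
    rewrite (le_trans _ (nneseries_lim_ge 1%N _)) //.
      by rewrite big_nat1 expe0 b0E mule1.
    by move=> n _; rewrite mule_ge0 ?lee_fin ?expe_ge0.
  by rewrite gt0_mulye // ltNge leey.
set S := (\sum_(0 <= n <oo) _)%E => rS.
have S_ge N : ((\sum_(i < N) b i * r0 ^+ i)%:E <= S)%E.
  rewrite (le_trans _ (nneseries_lim_ge N _)) //.
    rewrite -sumEFin big_mkord; apply: lee_sum => n _.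
    by rewrite EFinM EFin_expe.
  by move=> n _; rewrite -EFin_expe lee_fin term_ge0 // ltW.
have r0_gt0 : 0 < r0 by [].
have : S \is a fin_num.
  rewrite ge0_fin_numE; last by rewrite (le_trans _ (S_ge 0%N)) // big_ord0.
  rewrite ltNge leye_eq; apply/negP => /eqP Soo.
  by move: rS; rewrite Soo gt0_muley // ltNge leey.
move=> /fineK; move: (fine S) => s SE; rewrite -{}SE in rS S_ge.
have [cb Bs] := nneg_series_cvg (term_ge0 b_ge0 (ltW r0_gt0)) S_ge.
have [ca At] := outer_at_inverse (ltW r0_gt0) cb.
set t := r0 * _ in ca At.
have t_gt0 : 0 < t.
  by rewrite mulr_gt0 // (lt_le_trans ltr01) // inverse_sum_ge1 // ltW.
have tR : (t%:E < conv_radius a)%E.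
  by apply: le_lt_trans rS; rewrite -EFinM lee_fin ler_wpM2l // ltW.
have xle x : 0 < x -> (x%:E < conv_radius a)%E -> x <= r0 * limn (pseries a x).
  move=> x_gt0 xR; have cx := cvg_pseries_lt_radius (ltW x_gt0) xR.
  have A_gt0 : 0 < limn (pseries a x).
    apply: lt_le_trans (nneg_sum_le_lim (term_ge0 a_ge0 (ltW x_gt0)) 1 cx).
    by rewrite big_ord1 mulr1 a0E.
  rewrite -ler_pdivrMr // -lee_fin rE.
  apply: le_inverse_radius (ltW x_gt0) cx _; first by rewrite divr_ge0 // ltW.
  by rewrite divfK // gt_eqF.
exists r0, t; split => //; split=> //; apply/eqP; rewrite eq_le xle // andbT.
by rewrite ler_wpM2l // ltW.
Qed.

End Critical_point.

(** * The distribution attached to the critical point *)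

(** Convexity of the power function on [z, x]; used to bound n z^n by a
multiple of x^n, so that series may be differentiated termwise. *)
Lemma mulrn_expr_le (K : realFieldType) (z x : K) (n : nat) : 0 <= z -> z <= x ->
  (x - z) * (n.+1%:R * z ^+ n) + z ^+ n.+1 <= x ^+ n.+1.
Proof.
move=> z0 zx; elim: n => [|n IHn]; first by rewrite mul1r mulr1 !expr1 subrK.
have -> : (x - z) * (n.+2%:R * z ^+ n.+1) + z ^+ n.+2 =
    z * ((x - z) * (n.+1%:R * z ^+ n) + z ^+ n.+1) + (x - z) * z ^+ n.+1.
  by rewrite -natr1 !exprS; ring.
have -> : x ^+ n.+2 = z * x ^+ n.+1 + (x - z) * x ^+ n.+1 by rewrite !exprS; ring.
apply: lerD; first exact: ler_wpM2l.
by rewrite ler_wpM2l ?subr_ge0 // lerXn2r ?nnegrE // (le_trans z0).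
Qed.

Section Term_by_term_derivative.
Variables (K : realType) (a : nat -> K).
Hypothesis a_ge0 : forall n, 0 <= a n.

Lemma cvg_pseries_diffs (z x : K) : 0 <= z -> z < x ->
  cvgn (pseries a x) -> cvgn (pseries (pseries_diffs a) z).
Proof.
move=> z0 zx cx; have x0 : 0 <= x by rewrite (le_trans z0) // ltW.
have xz : 0 < x - z by rewrite subr_gt0.
have ax0 n : 0 <= a n * x ^+ n by rewrite mulr_ge0 ?exprn_ge0.
have [|//|//] := @nneg_series_cvg K (fun n => pseries_diffs a n * z ^+ n) _
  ((x - z)^-1 * limn (pseries a x)).
  by move=> n; rewrite !mulr_ge0 ?exprn_ge0.
move=> N; apply: le_trans (ler_wpM2l _ (nneg_sum_le_lim ax0 N.+1 cx)); last first.
  by rewrite invr_ge0 ltW.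
rewrite ler_pdivlMl // big_ord_recl mulr_sumr -[leLHS]add0r lerD //.
apply: ler_sum => i _; rewrite /pseries_diffs lift0.
rewrite [_.+1%:R * _]mulrC -mulrA mulrCA ler_wpM2l // (le_trans _ (mulrn_expr_le i z0 (ltW zx))) //.
by rewrite lerDl exprn_ge0.
Qed.

(** The Euler operator x d/dx produces the moments of a distribution from its
generating function. *)
Lemma cvg_pseries_euler (z x : K) : 0 <= z -> z < x ->
  cvgn (pseries a x) ->
  pseries (fun n => n%:R * a n) z @ \oo --> z * limn (pseries (pseries_diffs a) z).
Proof.
move=> z0 zx cx; have := pseries_diffs_equiv (cvg_pseries_diffs z0 zx cx).
move=> /(cvgMl_tmp (a := z)); apply: cvg_trans; apply: near_eq_cvg; near=> N.
rewrite /pseries !seriesEord /= mulr_sumr; apply: eq_bigr => -[[|i] /= _] _.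
  by rewrite !mul0r mulr0.
by rewrite exprS; ring.
Unshelve. all: by end_near. Qed.

End Term_by_term_derivative.

Section Critical_distribution.
Variables (K : realType) (a : nat -> K) (r0 t : K).
Hypothesis a_ge0 : forall n, 0 <= a n.
Hypotheses (r0_gt0 : 0 < r0) (t_gt0 : 0 < t).
Hypothesis t_lt : (t%:E < conv_radius a)%E.
Hypothesis tE : r0 * limn (pseries a t) = t.
Hypothesis t_min : forall x, 0 < x -> (x%:E < conv_radius a)%E ->
  x <= r0 * limn (pseries a x).

(* As r0 A(t) = t, the factor r0 / t is the normalisation 1 / A(t). *)
Let p k := r0 / t * (a k * t ^+ k).

Let exists_between (x : K) : (x%:E < conv_radius a)%E ->
  exists2 y, x < y & (y%:E < conv_radius a)%E.
Proof.
case: (conv_radius a) => [R0| |] //; rewrite ?lte_fin => xR.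
  exists ((x + R0) / 2); rewrite ?lte_fin; lra.
by exists (x + 1); rewrite ?ltry //; lra.
Qed.

(** Fermat's criterion for the minimum of r0 A(x) - x at the interior
point t. *)
Lemma critical_derivative : r0 * limn (pseries (pseries_diffs a) t) = 1.
Proof.
have [y ty yR] := exists_between t_lt.
have [y1 yy1 y1R] := exists_between yR.
have [y2 y12 y2R] := exists_between y1R.
have y_gt0 : 0 < y by apply: lt_trans ty.
have y1_gt0 : 0 < y1 by apply: lt_trans yy1.
have y2_gt0 : 0 < y2 by apply: lt_trans y12.
have da_ge0 n : 0 <= pseries_diffs a n by rewrite mulr_ge0.
have c2 := cvg_pseries_lt_radius (ltW y2_gt0) y2R.
have d1 := cvg_pseries_diffs a_ge0 (ltW y1_gt0) y12 c2.
have dd := cvg_pseries_diffs da_ge0 (ltW y_gt0) yy1 d1.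
have d0 : cvgn (pseries (pseries_diffs a) y).
  by apply: is_cvg_pseries_inside d1 _; rewrite !gtr0_norm.
have c0 : cvgn (pseries a y).
  by apply: is_cvg_pseries_inside c2 _; rewrite !gtr0_norm // (lt_trans yy1).
have dA x : x \in `]0, y[ -> is_derive x 1 (fun x => limn (pseries a x))
    (limn (pseries (pseries_diffs a) x)).
  rewrite in_itv /= => /andP[x0 xy].
  by apply: (pseries_snd_diffs c0 d0 dd); rewrite !gtr0_norm.
pose f x := r0 * limn (pseries a x) - x.
have df x : x \in `]0, y[ ->
    is_derive x 1 f (r0 * limn (pseries (pseries_diffs a) x) - 1).
  move=> xy; have dAx := dA x xy.
  exact: is_deriveB.
have ty0 : t \in `]0, y[ by rewrite in_itv /= t_gt0.
have f_min x : x \in `]0, y[ -> f t <= f x.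
  rewrite in_itv /= => /andP[x0 xy]; rewrite /f tE subrr subr_ge0 t_min //.
  by rewrite (lt_trans _ yR) // lte_fin.
have ft0 := derive1_at_min (ltW y_gt0) (fun x xy => @ex_derive _ _ _ _ _ _ _ (df x xy)) ty0 f_min.
have := @derive_val _ _ _ _ _ _ _ (df t ty0).
rewrite derive_val => /eqP; rewrite eq_sym subr_eq0 => /eqP //.
Qed.

Lemma critical_total : series p @ \oo --> (1 : K).
Proof.
have := horner_poly_cvg (cvg_pseries_lt_radius (ltW t_gt0) t_lt).
move=> /(cvgMl_tmp (a := r0 / t)).
rewrite mulrAC tE divff ?gt_eqF //; apply: cvg_trans; apply: near_eq_cvg.
by near=> N; rewrite horner_poly mulr_sumr seriesEord.
Unshelve. all: by end_near. Qed.

Lemma critical_mean : series (fun k => k%:R * p k) @ \oo --> (1 : K).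
Proof.
have [y ty yR] := exists_between t_lt.
have cy := cvg_pseries_lt_radius (ltW (lt_trans t_gt0 ty)) yR.
have := cvg_pseries_euler a_ge0 (ltW t_gt0) ty cy.
move=> /(cvgMl_tmp (a := r0 / t)); rewrite mulrA divfK ?gt_eqF // critical_derivative.
apply: cvg_trans; apply: near_eq_cvg; near=> N.
rewrite /pseries !seriesEord /= mulr_sumr; apply: eq_bigr => k _.
by rewrite /p; ring.
Unshelve. all: by end_near. Qed.

(** Two points y < y1 are inserted between t and R because each application of
the Euler operator costs a little of the domain of convergence. *)
Lemma critical_second_moment :
  exists C : K, forall N, \sum_(k < N) k%:R ^+ 2 * p k <= C.
Proof.
have [y ty yR] := exists_between t_lt.
have [y1 yy1 y1R] := exists_between yR.
have y_gt0 : 0 < y by apply: lt_trans ty.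
have cy := cvg_pseries_lt_radius (ltW (lt_trans y_gt0 yy1)) y1R.
have ka_ge0 n : 0 <= n%:R * a n by rewrite mulr_ge0.
have cka := cvgP _ (cvg_pseries_euler a_ge0 (ltW y_gt0) yy1 cy).
have ckka := cvgP _ (cvg_pseries_euler ka_ge0 (ltW t_gt0) ty cka).
exists (r0 / t * limn (pseries (fun n => n%:R * (n%:R * a n)) t)) => N.
have ge0 n : 0 <= n%:R * (n%:R * a n) * t ^+ n.
  by rewrite !mulr_ge0 // exprn_ge0 // ltW.
apply: le_trans (ler_wpM2l _ (nneg_sum_le_lim ge0 N ckka)); last first.
  by rewrite divr_ge0 // ltW.
by rewrite mulr_sumr; apply: ler_sum => k _; rewrite /p; lra.
Qed.

End Critical_distribution.

(** * Aperiodicity *)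

(** Let d be the least positive difference of two elements y and y + d. It
divides every x of S: if x = e d + f with 0 < f < d, then (e + 1) (y + d) and
x + (e + 1) y would be elements at distance d - f < d. Hence d divides the
gcd, which is 1. *)
Lemma addition_closed_consecutive (S : set nat) :
  S 0%N -> (forall m n, S m -> S n -> S (m + n)%N) ->
  (forall e, (forall n, S n -> (e %| n)%N) -> (e %| 1)%N) ->
  exists q, S q /\ S q.+1.
Proof.
move=> S0 SD Sgcd.
pose D := [pred d | `[< (0 < d)%N /\ exists x, S x /\ S (x + d)%N >]].
have exD : exists d, D d.
  apply: contrapT => nD; suff /Sgcd : forall n, S n -> (0 %| n)%N by [].
  move=> n Sn; rewrite dvd0n; case: posnP => // n_gt0; exfalso; apply: nD.
  by exists n; apply/asboolP; split=> //; exists 0%N; rewrite add0n.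
case: (ex_minnP exD) => d /asboolP[d_gt0 [y [Sy Syd]]] d_min.
have SM n x : S x -> S (n * x)%N.
  by move=> Sx; elim: n => // n IHn; rewrite mulSn; exact: SD.
have Sdvd x : S x -> (d %| x)%N.
  move=> Sx; rewrite /dvdn; case: posnP => // f_gt0; exfalso.
  have fd : (x %% d < d)%N by rewrite ltn_mod.
  have /d_min : D (d - x %% d)%N.
    apply/asboolP; split; first by rewrite subn_gt0.
    exists (x + (x %/ d).+1 * y)%N; split; first by apply: SD => //; exact: SM.
    suff -> : (x + (x %/ d).+1 * y + (d - x %% d) = (x %/ d).+1 * (y + d))%N.
      exact: SM.
    rewrite mulnDr mulSn [((x %/ d).+1 * d)%N]mulSn {1}(divn_eq x d); lia.
  by lia.
have := Sgcd _ Sdvd; rewrite dvdn1 => /eqP d1.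
by exists y; split=> //; rewrite -addn1 -d1.
Qed.

Section Aperiodic_powers.
Variables (K : realFieldType) (p : nat -> K).
Hypothesis p_ge0 : forall n, 0 <= p n.
Hypothesis p0_gt0 : 0 < p 0%N.
Hypothesis p_gcd : is_gcd_set [set n | (1 <= n)%N /\ 0 < p n] 1.

Let coefE m n N : (n < N)%N -> fps_exp p m n = ((\poly_(i < N) p i) ^+ m)`_n :=
  fun nN => fps_exp_coef p m nN.

Let fps_exp_gt0D m m' n n' : 0 < fps_exp p m n -> 0 < fps_exp p m' n' ->
  0 < fps_exp p (m + m') (n + n').
Proof.
have [nN n'N] : (n < (n + n').+1)%N /\ (n' < (n + n').+1)%N by lia.
rewrite (coefE m nN) (coefE m' n'N) (coefE _ (ltnSn _)) => mn m'n'.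
have np : nneg_coef (\poly_(i < (n + n').+1) p i) by exact: nneg_coef_poly.
rewrite exprD coefM (bigD1 (Ordinal nN)) //=.
rewrite addKn ltr_wpDr ?mulr_gt0 // sumr_ge0 // => i _.
by rewrite mulr_ge0 //; apply: nneg_coef_exp.
Qed.

Let fps_exp_1 n : fps_exp p 1 n = p n.
Proof. by rewrite (coefE 1 (ltnSn n)) expr1 coef_poly ltnSn. Qed.

Let fps_exp_0_gt0 m : 0 < fps_exp p m 0.
Proof.
elim: m => [|m IHm]; first exact: ltr01.
by rewrite -addn1 -(addn0 0%N); apply: fps_exp_gt0D; rewrite // fps_exp_1.
Qed.

(** The supports of the powers of p form an additive set, which contains some
q' and q' + 1; then 2q', 2q' + 1 and 2q' + 2 are sums of two elements. As
p 0 > 0, extra factors can be added to reach these three values with the same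
number of factors. *)
Lemma aperiodic_power_consecutive : exists m q, (0 < m)%N /\
  forall i, (i <= 2)%N -> 0 < fps_exp p m (q + i).
Proof.
have [|||q [[m1 q_gt0] [m2 q1_gt0]]] :=
    @addition_closed_consecutive [set n | exists m, 0 < fps_exp p m n].
- by exists 0%N; exact: ltr01.
- by move=> n n' [m mn] [m' m'n']; exists (m + m')%N; exact: fps_exp_gt0D.
- move=> e eS; apply: p_gcd.2 => n [_ pn_gt0]; apply: eS.
  by exists 1%N; rewrite fps_exp_1.
exists ((m1 + m1) + (m2 + m2))%N, (q + q)%N; split.
  case: m1 m2 q_gt0 q1_gt0 => [|//] [|//] _.
  by rewrite /fps_exp /fps_one /= ltxx.
case=> [|[|[|//]]] _.
- by rewrite addn0 -(addn0 (q + q)%N) !fps_exp_gt0D.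
- rewrite (_ : (q + q + 1 = q + q.+1 + (0 + 0))%N); last by lia.
  rewrite (_ : (m1 + m1 + (m2 + m2) = m1 + m2 + (m1 + m2))%N); last by lia.
  by rewrite !fps_exp_gt0D.
- rewrite (_ : (q + q + 2 = (0 + 0) + (q.+1 + q.+1))%N); last by lia.
  by rewrite !fps_exp_gt0D.
Qed.

End Aperiodic_powers.

(** * Symmetric binomial probabilities *)

Lemma central_bin_succ (k : nat) :
  (k.+1 * 'C(k.+1.*2, k.+1) = 2 * k.*2.+1 * 'C(k.*2, k))%N.
Proof.
rewrite doubleS -mul_bin_diag /=.
have h : (k.+1 * 'C(k.*2.+1, k) = k.*2.+1 * 'C(k.*2, k))%N.
  by have := mul_bin_down k.*2.+1 k; rewrite /= => ->; congr (_ * _)%N; lia.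
lia.
Qed.

(** The quantity C(2k, k)^2 (2k + 1) / 16^k decreases with k. *)
Lemma central_bin_upper (k : nat) : ('C(k.*2, k) ^ 2 * k.*2.+1 <= 16 ^ k)%N.
Proof.
elim: k => [//|k IHk].
have kk : (0 < k.+1 ^ 2)%N by rewrite expn_gt0.
rewrite -(leq_pmul2l kk) mulnA -expnMn central_bin_succ [(16 ^ _)%N]expnS.
have : (4 * k.*2.+1 * k.+1.*2.+1 <= 16 * k.+1 ^ 2)%N by nia.
move=> /leq_mul /(_ IHk); move: ('C(_, _)) (16 ^ k)%N => c s h.
rewrite (_ : (2 * _ * _) ^ 2 * _ = 4 * k.*2.+1 * k.+1.*2.+1 * (c ^ 2 * k.*2.+1))%N.
  by rewrite [leqRHS]mulnCA [leqRHS]mulnA.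
by rewrite -!mulnn -!muln2; ring.
Qed.

(** The quantity C(2k, k)^2 4k / 16^k increases with k. *)
Lemma central_bin_lower (k : nat) : (16 ^ k.+1 <= 'C(k.+1.*2, k.+1) ^ 2 * (4 * k.+1))%N.
Proof.
elim: k => [//|k IHk].
have kk : (0 < k.+2 ^ 2)%N by rewrite expn_gt0.
rewrite -(leq_pmul2l kk) [leqRHS]mulnA -expnMn central_bin_succ [(16 ^ k.+2)%N]expnS.
have : (16 * k.+2 ^ 2 * k.+1 <= 4 * k.+1.*2.+1 ^ 2 * k.+2)%N by nia.
move: ('C(_, _)) (16 ^ k.+1)%N IHk => c s IHk h.
rewrite -(leq_pmul2l (ltn0Sn k)).
apply: (@leq_trans (16 * k.+2 ^ 2 * k.+1 * (c ^ 2 * (4 * k.+1)))%N).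
  by rewrite (_ : (k.+1 * _ = 16 * k.+2 ^ 2 * k.+1 * s)%N); [rewrite leq_mul2l IHk orbT | ring].
apply: leq_trans (leq_mul h (leqnn _)) _.
by rewrite -!mulnn -!muln2; apply: eq_leq; ring.
Qed.

Lemma central_bin_max (k j : nat) : ('C(k.*2, j) <= 'C(k.*2, k))%N.
Proof.
have low d : (d <= k)%N -> ('C(k.*2, k - d) <= 'C(k.*2, k))%N.
  elim: d => [|d IHd] dk; first by rewrite subn0.
  apply: leq_trans (IHd (ltnW dk)).
  have := mul_bin_left k.*2 (k - d.+1).
  rewrite (_ : (k - d.+1).+1 = k - d)%N; last by lia.
  rewrite (_ : k.*2 - (k - d.+1) = k + d.+1)%N; last by lia.
  move=> h; rewrite -(leq_pmul2l (_ : 0 < k - d)%N) ?subn_gt0 // h.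
  by rewrite leq_mul2r; apply/orP; right; lia.
case: (leqP j k) => [jk|kj]; first by have := low (k - j)%N; rewrite subKn // => -> //; exact: leq_subr.
case: (leqP j k.*2) => jk; last by rewrite bin_small.
by rewrite -bin_sub //; have := low (j - k)%N; rewrite (_ : k - (j - k) = k.*2 - j)%N; [apply; lia | lia].
Qed.

(** Generating function of the number of heads in two fair tosses. Tosses are
taken in pairs so that the powers have a central coefficient. *)
Definition two_coins (K : fieldType) : {poly K} := 4^-1 *: (1 + 'X) ^+ 2.

Lemma coef_two_coins_exp (K : fieldType) (k j : nat) :
  ((two_coins K) ^+ k)`_j = 'C(k.*2, j)%:R / 4 ^+ k.
Proof.
have -> : (two_coins K) ^+ k =
    (4 ^+ k)^-1 *: \poly_(i < k.*2.+1) ('C(k.*2, i)%:R : K).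
  rewrite exprZn exprVn -exprM mul2n; congr (_ *: _); rewrite exprDn poly_def.
  by apply: eq_bigr => i _; rewrite expr1n mul1r scaler_nat.
rewrite coefZ coef_poly mulrC; case: ltnP => // kj.
by rewrite bin_small.
Qed.

Section Two_coins_bounds.
Variable K : realType.

Let g k j : K := ((two_coins K) ^+ k)`_j.

Let g_ge0 k j : 0 <= g k j.
Proof. by rewrite /g coef_two_coins_exp divr_ge0 ?ler0n // exprn_ge0. Qed.

Lemma two_coins_exp_upper k j : ((two_coins K) ^+ k)`_j <= (Num.sqrt k.+1%:R)^-1.
Proof.
have s_gt0 : 0 < Num.sqrt k.+1%:R :> K by rewrite sqrtr_gt0.
rewrite -[leRHS]div1r ler_pdivlMr // -(@ler_pXn2r _ 2) ?nnegrE //; last first.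
  by rewrite mulr_ge0 ?g_ge0 // ltW.
rewrite expr1n exprMn sqr_sqrtr // coef_two_coins_exp expr_div_n mulrAC.
rewrite -exprM mulnC exprM -natrX ler_pdivrMr ?exprn_gt0 // mul1r.
rewrite -!natrX -natrM ler_nat (leq_trans _ (central_bin_upper k)) //.
by apply: leq_mul; [rewrite leq_exp2r // central_bin_max | lia].
Qed.

Let g_centre k : (0 < k)%N -> (2 * Num.sqrt k%:R)^-1 <= g k k.
Proof.
case: k => // k _.
have s_gt0 : 0 < Num.sqrt k.+1%:R :> K by rewrite sqrtr_gt0.
rewrite -[leLHS]div1r ler_pdivrMr ?mulr_gt0 // -(@ler_pXn2r _ 2) ?nnegrE //; last first.
  by rewrite !mulr_ge0 ?g_ge0 // ltW.
rewrite expr1n /g coef_two_coins_exp !exprMn sqr_sqrtr // exprVn mulrAC.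
rewrite -exprM mulnC exprM ler_pdivlMr ?exprn_gt0 // mul1r.
by rewrite -!natrX -!natrM ler_nat; exact: central_bin_lower.
Qed.

Let g_sym k d : (d <= k)%N -> g k (k + d) = g k (k - d).
Proof.
move=> dk; rewrite /g !coef_two_coins_exp.
rewrite -(@bin_sub k.*2 (k + d)); last by lia.
by rewrite (_ : k.*2 - (k + d) = k - d)%N //; lia.
Qed.

(* Each of the d ratios of consecutive coefficients between k and k - d is at
   least 1 - 2 d / k. *)
Let g_decay k d i : (0 < k)%N -> (2 * d <= k)%N -> (i <= d)%N ->
  g k k * (1 - 2 * d%:R / k%:R) ^+ i <= g k (k - i).
Proof.
move=> k0 dk; elim: i => [|i IHi] id; first by rewrite expr0 mulr1 subn0.
have kR : 0 < k%:R :> K by rewrite ltr0n.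
have y1 : 0 <= 1 - 2 * d%:R / k%:R :> K.
  by rewrite subr_ge0 ler_pdivrMr // mul1r -natrM ler_nat.
rewrite exprSr mulrA; apply: le_trans (ler_wpM2r y1 (IHi (ltnW id))) _.
have step : (k + i.+1)%:R * g k (k - i.+1) = (k - i)%:R * g k (k - i).
  rewrite /g !coef_two_coins_exp !mulrA -!natrM; congr (_%:R / _).
  have := mul_bin_left k.*2 (k - i.+1).
  rewrite (_ : (k - i.+1).+1 = k - i)%N; last by lia.
  by rewrite (_ : k.*2 - (k - i.+1) = k + i.+1)%N; last by lia.
have ki : 0 < (k + i.+1)%:R :> K by rewrite ltr0n; lia.
rewrite -(ler_pM2l ki) step mulrCA [leRHS]mulrC ler_wpM2l ?g_ge0 //.
rewrite -(ler_pM2r kR) -[leLHS]mulrA mulrBl divfK ?gt_eqF // mul1r.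
have -> : (k - i)%:R = k%:R - i%:R :> K by rewrite natrB //; lia.
have : i%:R + 1 <= d%:R :> K by rewrite natr1 ler_nat.
have : 0 <= i%:R :> K by [].
by rewrite natrD -natr1; nra.
Qed.

(** At distance d from the centre the loss is at most a factor
(1 - 2 d / k)^d >= exp (- 4 d^2 / k), which stays bounded below when d is of
order sqrt k. *)
Lemma two_coins_exp_lower (A : K) k j : (0 < k)%N ->
  4 * `|j%:R - k%:R : K| <= k%:R -> 4 * (j%:R - k%:R) ^+ 2 <= A * k%:R ->
  expR (- A) / (2 * Num.sqrt k%:R) <= ((two_coins K) ^+ k)`_j.
Proof.
move=> k0 jk jkA; have kR : 0 < k%:R :> K by rewrite ltr0n.
have [d dk [dA gd]] : exists2 d, (4 * d <= k)%N &
    4 * d%:R ^+ 2 <= A * k%:R /\ g k j = g k (k - d).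
  have [kj|/ltnW kj] := leqP j k.
    exists (k - j)%N; last by rewrite subKn // natrB // -sqrrN opprB.
    by move: jk; rewrite distrC -natrB // ger0_norm // -natrM ler_nat.
  have jkd : (4 * (j - k) <= k)%N.
    by move: jk; rewrite -natrB // ger0_norm // -natrM ler_nat.
  exists (j - k)%N => //; split; first by rewrite natrB.
  by rewrite -g_sym ?subnKC //; lia.
rewrite -[leRHS]/(g k j) gd.
have d2k : (2 * d <= k)%N by lia.
apply: le_trans (g_decay k0 d2k (leqnn d)).
rewrite [leLHS]mulrC; apply: ler_pM => //; first exact: g_centre.
set y := 2 * d%:R / k%:R.
have y0 : 0 <= y by rewrite divr_ge0 // mulr_ge0.
have y2 : y <= 2^-1.
  rewrite ler_pdivrMr // ler_pdivlMl // mulrA -!natrM ler_nat; lia.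
(* 1 / (1 - y) <= 1 + 2 y <= exp (2 y) as y <= 1/2 *)
have expy : expR (- (2 * y)) <= 1 - y.
  rewrite expRN -[leLHS]div1r ler_pdivrMr ?expR_gt0 //.
  have := expR_ge1Dx (2 * y); nra.
apply: (@le_trans _ _ (expR (- (2 * y)) ^+ d)); last first.
  by rewrite lerXn2r ?nnegrE ?expR_ge0 //; lra.
rewrite -expRM_natl ler_expR mulrN lerN2.
by rewrite /y !mulrA ler_pdivrMr //; nra.
Qed.

End Two_coins_bounds.

(** * First two moments of a polynomial about a point *)

Section Centred_moments.
Variable K : comNzRingType.
Implicit Types (U V : {poly K}) (c d : K).

Definition euler U : {poly K} := 'X * U^`().

Lemma coef_euler U i : (euler U)`_i = i%:R * U`_i.
Proof. by rewrite coefXM coef_deriv; case: i => [|i]; rewrite ?mul0r ?mulr_natl. Qed.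

(** For a polynomial with coefficients U_i, [moment1 c] is the sum of the
U_i (i - c) and [moment2 c] that of the U_i (i - c)^2. Through the Euler
operator they are derivatives at 1, for which products are easy. *)
Definition moment1 c U := (euler U).[1] - c * U.[1].

Definition moment2 c U :=
  (euler (euler U)).[1] - 2 * c * (euler U).[1] + c ^+ 2 * U.[1].

Let euler_horner1M U V :
  (euler (U * V)).[1] = (euler U).[1] * V.[1] + U.[1] * (euler V).[1].
Proof. by rewrite /euler derivM !(hornerM, hornerD, hornerX) !mul1r. Qed.

Lemma moment1M c d U V :
  moment1 (c + d) (U * V) = moment1 c U * V.[1] + U.[1] * moment1 d V.
Proof. by rewrite /moment1 euler_horner1M [(U * V).[1]]hornerM; ring. Qed.

(** Variance of a sum of independent variables, for measures that need not
have mass 1. *)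
Lemma moment2M c d U V : moment2 (c + d) (U * V) =
  moment2 c U * V.[1] + 2 * moment1 c U * moment1 d V + U.[1] * moment2 d V.
Proof.
have eulerM : euler (U * V) = euler U * V + U * euler V.
  by rewrite /euler derivM mulrDr mulrA; congr (_ + _); exact: mulrCA.
have eulerD W1 W2 : (euler (W1 + W2)).[1] = (euler W1).[1] + (euler W2).[1].
  by rewrite /euler derivD mulrDr hornerD.
rewrite /moment2 /moment1 eulerM eulerD !euler_horner1M [(_ + _).[1]]hornerD.
rewrite [(U * V).[1]]hornerM [(_ * V).[1]]hornerM [(U * _).[1]]hornerM; ring.
Qed.

Lemma moment2_sum c (I : Type) (r : seq I) (a : I -> K) (P : I -> {poly K}) :
  moment2 c (\sum_(i <- r) a i *: P i) = \sum_(i <- r) a i * moment2 c (P i).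
Proof.
elim/big_rec2: _ => [|i x U _ <-].
  by rewrite /moment2 /euler deriv0 mulr0 deriv0 mulr0 !horner0 !mulr0 subr0 addr0.
have eulerL W1 W2 : euler (a i *: W1 + W2) = a i *: euler W1 + euler W2.
  by rewrite /euler derivD derivZ mulrDr scalerAr.
rewrite /moment2 !eulerL !hornerD !hornerZ; ring.
Qed.

Let size_euler_le U (L : nat) : (size U <= L)%N -> (size (euler U) <= L)%N.
Proof.
move=> /leq_sizeP U0; apply/leq_sizeP => j Lj.
by rewrite coef_euler U0 ?mulr0.
Qed.

Lemma moment1E c U (L : nat) : (size U <= L)%N ->
  moment1 c U = \sum_(i < L) U`_i * (i%:R - c).
Proof.
move=> UL; rewrite /moment1 (horner_coef_wide _ (size_euler_le UL)).
rewrite (horner_coef_wide _ UL) mulr_sumr -sumrB; apply: eq_bigr => i _.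
by rewrite coef_euler !expr1n; ring.
Qed.

Lemma moment2E c U (L : nat) : (size U <= L)%N ->
  moment2 c U = \sum_(i < L) U`_i * (i%:R - c) ^+ 2.
Proof.
move=> UL; have eUL := size_euler_le UL.
rewrite /moment2 (horner_coef_wide _ (size_euler_le eUL)).
rewrite (horner_coef_wide _ eUL) (horner_coef_wide _ UL).
rewrite !mulr_sumr -sumrB -big_split /=; apply: eq_bigr => i _.
by rewrite !coef_euler !expr1n; ring.
Qed.

End Centred_moments.

Section Moments_of_powers.
Variable K : realFieldType.
Implicit Types (U V : {poly K}) (c : K).

Lemma moment2_ge0 c U : nneg_coef U -> 0 <= moment2 c U.
Proof.
move=> U0; rewrite (moment2E _ (leqnn _)) sumr_ge0 // => i _.
by rewrite mulr_ge0 // sqr_ge0.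
Qed.

Let horner1_exp_le1 U k : nneg_coef U -> U.[1] <= 1 -> 0 <= (U ^+ k).[1] <= 1.
Proof.
move=> U0 U1; have U1_ge0 := horner_nneg_ge0 U0 (@ler01 K).
by rewrite horner_exp exprn_ge0 //= exprn_ile1.
Qed.

Lemma moment1_exp_le c U k : nneg_coef U -> U.[1] <= 1 ->
  `|moment1 (k%:R * c) (U ^+ k)| <= k%:R * `|moment1 c U|.
Proof.
move=> U0 U1; have U1_ge0 := horner_nneg_ge0 U0 (@ler01 K).
elim: k => [|k IHk].
  by rewrite !mul0r expr0 /moment1 /euler derivC mulr0 horner0 mul0r subr0 normr0.
rewrite -nat1r mulrDl mul1r exprS moment1M (le_trans (ler_normD _ _)) //.
rewrite [leRHS]mulrDl mul1r !normrM lerD //.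
  have /andP[h0 h1] := horner1_exp_le1 k U0 U1.
  by rewrite ler_piMr // ger0_norm.
by rewrite (le_trans _ IHk) // ler_piMl // ger0_norm.
Qed.

(** The second term is the squared bias that truncation introduces; the
variance proper grows linearly with k. *)
Lemma moment2_exp_le c U k : nneg_coef U -> U.[1] <= 1 ->
  moment2 (k%:R * c) (U ^+ k) <=
  k%:R * moment2 c U + (k%:R * moment1 c U) ^+ 2.
Proof.
move=> U0 U1; have U1_ge0 := horner_nneg_ge0 U0 (@ler01 K).
have m2 := moment2_ge0 c U0.
elim: k => [|k IHk].
  rewrite !mul0r expr0 /moment2 /euler derivC mulr0 deriv0 mulr0 horner0.
  by rewrite mulr0 subrr expr0n mul0r !addr0.
rewrite -nat1r mulrDl mul1r exprS moment2M.
have /andP[h0 h1] := horner1_exp_le1 k U0 U1.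
have m1 : moment1 c U * moment1 (k%:R * c) (U ^+ k) <= k%:R * moment1 c U ^+ 2.
  apply: le_trans (ler_norm _) _; rewrite normrM.
  apply: le_trans (ler_wpM2l (normr_ge0 _) (moment1_exp_le c k U0 U1)) _.
  by rewrite mulrCA -expr2 real_normK // num_real.
have k0 : 0 <= k%:R :> K by [].
have : 0 <= moment2 (k%:R * c) (U ^+ k) by apply/moment2_ge0/nneg_coef_exp.
have : 0 <= moment1 c U ^+ 2 by exact: sqr_ge0.
nra.
Qed.

(** Adding an independent centred variable increases the second moment. *)
Lemma moment2_shift_le c d U V : nneg_coef U -> nneg_coef V ->
  V.[1] = 1 -> moment1 d V = 0 -> moment2 c U <= moment2 (c + d) (U * V).
Proof.
move=> U0 V0 V1 m1V; rewrite moment2M V1 m1V mulr1 mulr0 addr0 lerDl.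
by rewrite mulr_ge0 ?moment2_ge0 ?horner_nneg_ge0.
Qed.

Lemma coef_mul_le U V B n : nneg_coef U -> 0 <= B -> (forall i, V`_i <= B) ->
  (U * V)`_n <= U.[1] * B.
Proof.
move=> U0 B0 VB; have := sum_coef_le_horner n.+1 U0 (@ler01 K).
move=> /(ler_wpM2r B0); apply: le_trans.
rewrite coefM mulr_suml; apply: ler_sum => i _.
by rewrite expr1n mulr1 ler_wpM2l.
Qed.

End Moments_of_powers.

(** * Extracting coin tosses from a power *)

Section Mixture.
Variables (K : realType) (F H : {poly K}) (eps : K) (m q : nat).

(* [F] is the truncated law p, and F^m is the mixture of eps times the law V
   of q plus two tosses with a remainder H. *)
Let V : {poly K} := 'X^q * two_coins K.

Hypotheses (F_ge0 : nneg_coef F) (F_le1 : F.[1] <= 1) (H_ge0 : nneg_coef H).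
Hypothesis eps_gt0 : 0 < eps.
Hypothesis FE : F ^+ m = H + eps *: V.

Let coef_V_exp k j : (V ^+ k)`_j =
  if (j < q * k)%N then 0 else ((two_coins K) ^+ k)`_(j - q * k).
Proof. by rewrite /V exprMn -exprM coefXnM. Qed.

Let V_exp_ge0 k : nneg_coef (V ^+ k).
Proof.
move=> j; rewrite coef_V_exp; case: ifP => // _.
by rewrite coef_two_coins_exp divr_ge0 // exprn_ge0.
Qed.

Let V_exp_le k j : (V ^+ k)`_j <= (Num.sqrt k.+1%:R)^-1.
Proof.
rewrite coef_V_exp; case: ifP => _; last exact: two_coins_exp_upper.
by rewrite invr_ge0 sqrtr_ge0.
Qed.

Let V_horner1 : V.[1] = 1.
Proof.
rewrite /V /two_coins hornerM hornerXn expr1n hornerZ horner_exp hornerD hornerX.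
by rewrite hornerC; field.
Qed.

Let V_moment1 : moment1 (q%:R + 1) V = 0.
Proof.
rewrite moment1M; have -> : moment1 q%:R 'X^q = 0 :> K.
  rewrite /moment1 /euler derivXn hornerM hornerX mul1r hornerMn !hornerXn !expr1n.
  by rewrite mulr1 subrr.
have -> : moment1 1 (two_coins K) = 0.
  rewrite /moment1 /euler /two_coins derivZ deriv_exp derivD derivX derivC add0r.
  rewrite mul1r !(hornerM, hornerX, hornerZ, hornerMn, horner_exp, hornerD, hornerC).
  by field.
by rewrite mul0r mulr0 addr0.
Qed.

Let V_exp_horner1 k : (V ^+ k).[1] = 1.
Proof. by rewrite horner_exp V_horner1 expr1n. Qed.

Let V_exp_moment1 k : moment1 (k%:R * (q%:R + 1)) (V ^+ k) = 0.
Proof.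
have V0 : nneg_coef V by have := V_exp_ge0 1; rewrite expr1.
apply/eqP; rewrite -normr_le0.
have := moment1_exp_le (q%:R + 1) k V0 _.
by rewrite V_horner1 V_moment1 normr0 mulr0; apply.
Qed.

Section Number_of_factors.
Variables (M s : nat).

(* [U k] is the part of the sum that is independent of the coins, when k of
   the M factors F^m come from V, and [wgt k] the binomial factor of that event. *)
Let U k := F ^+ s * H ^+ (M - k).
Let wgt k : K := eps ^+ k * 'C(M, k)%:R.

Let U_ge0 k : nneg_coef (U k).
Proof. by apply: nneg_coefM; apply: nneg_coef_exp. Qed.

Let wgt_ge0 k : 0 <= wgt k.
Proof. by rewrite mulr_ge0 // exprn_ge0 // ltW. Qed.

Lemma mixture_expansion :
  F ^+ (m * M + s) = \sum_(k < M.+1) wgt k *: (U k * V ^+ k).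
Proof.
rewrite exprD exprM FE exprDn mulr_suml; apply: eq_bigr => k _.
rewrite exprZn -scalerAr mulrnAl -scalerAl -scaler_nat scalerA.
by congr (_ *: _); [exact: mulrC | rewrite mulrC mulrA].
Qed.

Let total_weight : \sum_(k < M.+1) wgt k * (U k).[1] = F.[1] ^+ (m * M + s).
Proof.
rewrite -horner_exp mixture_expansion horner_sum; apply: eq_bigr => k _.
by rewrite hornerZ [in RHS]hornerM V_exp_horner1 mulr1.
Qed.

Let total_weight_le1 : \sum_(k < M.+1) wgt k * (U k).[1] <= 1.
Proof. by rewrite total_weight exprn_ile1 // horner_nneg_ge0. Qed.

(** The expectation of 1 / (k + 1) for a binomial k has a closed form, because
C(M, k) / (k + 1) = C(M + 1, k + 1) / (M + 1). *)
Lemma mean_inverse_count_le :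
  \sum_(k < M.+1) wgt k * (U k).[1] / k.+1%:R <= (M.+1%:R * eps)^-1.
Proof.
have F1_ge0 : 0 <= F.[1] by rewrite horner_nneg_ge0.
set h := H.[1]; have h0 : 0 <= h by rewrite horner_nneg_ge0.
have he : h + eps <= 1.
  have -> : h + eps = F.[1] ^+ m by rewrite -horner_exp FE hornerD hornerZ V_horner1 mulr1.
  by rewrite exprn_ile1.
have Me : 0 < M.+1%:R * eps by rewrite mulr_gt0.
apply: (@le_trans _ _ ((M.+1%:R * eps)^-1 * (h + eps) ^+ M.+1)); last first.
  by rewrite ler_piMr ?invr_ge0 ?exprn_ile1 ?addr_ge0 // ltW.
rewrite exprDn [in leRHS]big_ord_recl mulrDr ler_wpDl //.
  by rewrite mulr_ge0 ?invr_ge0 ?mulrn_wge0 ?mulr_ge0 ?exprn_ge0 // ltW.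
rewrite mulr_sumr; apply: ler_sum => k _; rewrite lift0 subSS.
have Uk : (U k).[1] <= h ^+ (M - k).
  rewrite hornerM !horner_exp ler_piMl ?exprn_ge0 ?exprn_ile1 //.
apply: (@le_trans _ _ (wgt k * h ^+ (M - k) / k.+1%:R)).
  by rewrite ler_wpM2r ?invr_ge0 // ler_wpM2l.
rewrite ler_pdivrMr // -[leRHS]mulrA ler_pdivlMl // /wgt -[(_ * _) *+ _]mulr_natr.
have := mul_bin_diag M.+1 k; rewrite /= => /(congr1 (fun n => n%:R : K)).
rewrite !natrM => binE.
rewrite (_ : M.+1%:R * eps * _ = eps ^+ k.+1 * h ^+ (M - k) * (M.+1%:R * 'C(M, k)%:R)).
  by rewrite binE le_eqVlt; apply/predU1P; left; ring.
by rewrite exprS; ring.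
Qed.

(** Given k, the point probability is at most 1 / sqrt (k + 1). With
l = sqrt (M + 1), the inequality 2 y^-1 <= l y^-2 + l^-1 for
y = sqrt (k + 1) reduces its expectation to that of 1 / (k + 1). *)
Lemma mixture_coef_upper n : (F ^+ (m * M + s))`_n <=
  2^-1 * (eps^-1 + 1) / Num.sqrt M.+1%:R.
Proof.
set l := Num.sqrt M.+1%:R.
have l_gt0 : 0 < l by rewrite sqrtr_gt0.
have l2 : l ^+ 2 = M.+1%:R by rewrite sqr_sqrtr.
have amgm (k : nat) : (Num.sqrt k.+1%:R)^-1 <= 2^-1 * (l / k.+1%:R + l^-1) :> K.
  set y := Num.sqrt _; have y_gt0 : 0 < y by rewrite sqrtr_gt0.
  rewrite (_ : k.+1%:R = y ^+ 2); last by rewrite sqr_sqrtr.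
  rewrite -subr_ge0 (_ : _ - _ = 2^-1 * l * (y^-1 - l^-1) ^+ 2).
    by apply: mulr_ge0; [apply: mulr_ge0 => //; exact: ltW | exact: sqr_ge0].
  by field; rewrite !gt_eqF.
rewrite mixture_expansion coef_sum.
apply: (@le_trans _ _ (\sum_(k < M.+1) wgt k * ((U k).[1] * (2^-1 * (l / k.+1%:R + l^-1))))).
  apply: ler_sum => k _; rewrite coefZ ler_wpM2l //.
  apply: coef_mul_le => // [|j]; last exact: le_trans (V_exp_le k j) (amgm k).
  by rewrite !mulr_ge0 ?addr_ge0 ?divr_ge0 ?invr_ge0 // ltW.
rewrite (_ : \sum_(k < M.+1) _ = 2^-1 * (l * (\sum_(k < M.+1) wgt k * (U k).[1] / k.+1%:R)
    + (\sum_(k < M.+1) wgt k * (U k).[1]) / l)); last first.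
  rewrite mulr_sumr mulr_suml -big_split mulr_sumr; apply: eq_bigr => k _ /=.
  by field; rewrite nat1r pnatr_eq0 andbT gt_eqF.
rewrite -mulrA ler_wpM2l // mulrDl mul1r lerD //; last first.
  by rewrite -[leRHS]mul1r ler_wpM2r // invr_ge0 ltW.
apply: le_trans (ler_wpM2l (ltW l_gt0) mean_inverse_count_le) _.
rewrite -l2 le_eqVlt; apply/predU1P; left; field.
by rewrite !gt_eqF.
Qed.

(** The hypothesis on V bounds the point probabilities of the coins below by
D (1 - k0 / (k + 1) - x^2 / W), where x is the distance of the conditional
mean of the sum to its target. This quantity is at most D, and at most 0 when k
is small or x is large. It is affine in 1 / (k + 1) and x^2, so summing it
performs at once the Markov and Chebyshev bounds, without splitting the
sum into good and bad events; each of them removes at most D / 4 from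
3 D / 4. *)
Lemma mixture_coef_lower (k0 W D : K) (n : nat) :
  0 < W -> 0 <= D ->
  k0 / (M.+1%:R * eps) <= 4^-1 ->
  moment2 (m * M + s)%:R (F ^+ (m * M + s)) <= W / 4 ->
  3 / 4 <= F.[1] ^+ (m * M + s) -> 0 <= k0 ->
  (forall k w, (k <= M)%N ->
    D * (1 - k0 / k.+1%:R - (w%:R - ((m * M + s)%:R - k%:R * (q%:R + 1))) ^+ 2 / W)
    <= if (w <= n)%N then (V ^+ k)`_(n - w) else 0) ->
  D / 4 <= (F ^+ (m * M + s))`_n.
Proof.
set N := (m * M + s)%N => W_gt0 D0 k0M m2F F1 k0_ge0 Vlow.
pose c (k : nat) : K := N%:R - k%:R * (q%:R + 1).
have term k : (k <= M)%N ->
    D * ((1 - k0 / k.+1%:R) * (U k).[1] - moment2 (c k) (U k) / W) <= (U k * V ^+ k)`_n.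
  move=> kM; pose L := (n.+1 + size (U k))%N.
  rewrite (moment2E _ (leq_addl n.+1 _)) (horner_coef_wide _ (leq_addl n.+1 (size (U k)))).
  rewrite coefM (big_ord_widen L (fun w => (U k)`_w * (V ^+ k)`_(n - w))) ?leq_addr //.
  rewrite [leRHS]big_mkcond mulr_sumr mulr_suml -sumrB mulr_sumr.
  apply: ler_sum => w _; have := Vlow k w kM; rewrite ltnS => /(ler_wpM2l (U_ge0 k w)).
  rewrite (fun_if (fun x => _ * x)) mulr0; apply: le_trans.
  by rewrite expr1n /c le_eqVlt; apply/predU1P; left; ring.
rewrite mixture_expansion coef_sum.
apply: (@le_trans _ _ (\sum_(k < M.+1)
    wgt k * (D * ((1 - k0 / k.+1%:R) * (U k).[1] - moment2 (c k) (U k) / W)))); last first.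
  apply: ler_sum => k _; rewrite coefZ ler_wpM2l // term //.
  by rewrite -ltnS.
have m2 : \sum_(k < M.+1) wgt k * moment2 (c k) (U k) <= W / 4.
  apply: le_trans m2F; rewrite mixture_expansion moment2_sum.
  apply: ler_sum => k _; rewrite ler_wpM2l //.
  have := moment2_shift_le (c k) (U_ge0 k) (V_exp_ge0 k) (V_exp_horner1 k) (V_exp_moment1 k).
  by rewrite /c subrK.
rewrite (_ : \sum_(k < M.+1) _ = D * (\sum_(k < M.+1) wgt k * (U k).[1]
   - k0 * (\sum_(k < M.+1) wgt k * (U k).[1] / k.+1%:R)
   - (\sum_(k < M.+1) wgt k * moment2 (c k) (U k)) / W)); last first.
  by rewrite mulr_sumr mulr_suml -!sumrB mulr_sumr; apply: eq_bigr => k _ /=; ring.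
rewrite ler_wpM2l // total_weight.
have k0E := le_trans (ler_wpM2l k0_ge0 mean_inverse_count_le) k0M.
have : (\sum_(k < M.+1) wgt k * moment2 (c k) (U k)) / W <= 4^-1.
  by rewrite ler_pdivrMr // mulrC.
lra.
Qed.

End Number_of_factors.

End Mixture.

(** * Local estimate for sums of independent variables *)

Lemma series_tail_le (K : realType) (u v : nat -> K) (l B : K) (N : nat) :
  series u @ \oo --> l -> (forall k, (N <= k)%N -> `|u k| <= v k) ->
  (forall k, 0 <= v k) -> (forall m, \sum_(k < m) v k <= B) ->
  `|l - \sum_(k < N) u k| <= B.
Proof.
move=> ul uv v0 vB.
have cn : `|series u m - \sum_(k < N) u k| @[m --> \oo] --> `|l - \sum_(k < N) u k|.
  by apply: cvg_norm; apply: cvgB => //; exact: cvg_cst.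
rewrite -(cvg_lim _ cn) //; apply: limr_le; first exact: cvgP cn.
near=> m; have Nm : (N <= m)%N by near: m; exact: nbhs_infty_ge.
rewrite seriesEord /= (big_ord_widen m u Nm) (bigID (fun k : 'I_m => (k < N)%N)) /=.
rewrite addrAC subrr add0r (le_trans (ler_norm_sum _ _ _)) //.
apply: le_trans (vB m); rewrite [leRHS](bigID (fun k : 'I_m => (k < N)%N)) /=.
rewrite ler_wpDl ?sumr_ge0 //.
by apply: ler_sum => k; rewrite -leqNgt; exact: uv.
Unshelve. all: by end_near. Qed.

Lemma bernoulli_expr_ge (K : realFieldType) (x : K) (n : nat) : 0 <= x -> x <= 1 ->
  1 - n%:R * (1 - x) <= x ^+ n.
Proof.
move=> x0 x1; elim: n => [|n IHn]; first by rewrite mul0r subr0.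
have : 0 <= n%:R * (1 - x) ^+ 2 by rewrite mulr_ge0 ?sqr_ge0.
have := ler_wpM2l x0 IHn; rewrite -exprS -natr1; lra.
Qed.

Section Local_limit.
Variables (K : realType) (p : nat -> K) (C : K).
Hypothesis p_ge0 : forall n, 0 <= p n.
Hypothesis p0_gt0 : 0 < p 0%N.
Hypothesis p_gcd : is_gcd_set [set n | (1 <= n)%N /\ 0 < p n] 1.
Hypothesis p_total : series p @ \oo --> (1 : K).
Hypothesis p_mean : series (fun k => k%:R * p k) @ \oo --> (1 : K).
Hypothesis p_second : forall N, \sum_(k < N) k%:R ^+ 2 * p k <= C.

Let F N : {poly K} := \poly_(i < N) p i.

Let C_ge0 : 0 <= C.
Proof. by have := p_second 0; rewrite big_ord0. Qed.

Let F_ge0 N : nneg_coef (F N).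
Proof. exact: nneg_coef_poly. Qed.

Let F_horner1 N : (F N).[1] = \sum_(k < N) p k.
Proof. by rewrite horner_poly; apply: eq_bigr => k _; rewrite expr1n mulr1. Qed.

Let F_le1 N : (F N).[1] <= 1.
Proof.
rewrite F_horner1 -[leRHS](cvg_lim _ p_total) //.
by apply: nneg_sum_le_lim => //; exact: cvgP p_total.
Qed.

Let F_defect N : (0 < N)%N -> 1 - (F N).[1] <= C / N%:R ^+ 2.
Proof.
move=> N0; have NR : 0 < N%:R :> K by rewrite ltr0n.
apply: le_trans (ler_norm _) _; rewrite F_horner1.
apply: (series_tail_le (v := fun k => k%:R ^+ 2 * p k / N%:R ^+ 2)) p_total _ _ _.
- move=> k Nk; rewrite ger0_norm // ler_pdivlMr ?exprn_gt0 // mulrC.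
  by rewrite ler_wpM2r // lerXn2r ?nnegrE // ler_nat.
- by move=> k; rewrite divr_ge0 ?mulr_ge0 ?exprn_ge0.
- by move=> m; rewrite -mulr_suml ler_wpM2r ?invr_ge0 ?exprn_ge0.
Qed.

Let F_moment1 N : (0 < N)%N -> `|moment1 1 (F N)| <= C / N%:R.
Proof.
move=> N0; have NR : 0 < N%:R :> K by rewrite ltr0n.
have -> : moment1 1 (F N) = \sum_(k < N) (k%:R - 1) * p k.
  rewrite (moment1E _ (size_poly _ _)); apply: eq_bigr => k _.
  by rewrite coef_poly ltn_ord mulrC.
have lim0 : series (fun k => (k%:R - 1) * p k) @ \oo --> (1 - 1 : K).
  apply: cvg_trans (cvgB p_mean p_total); apply: near_eq_cvg; near=> M.
  by rewrite !fctE !seriesEord /= -sumrB; apply: eq_bigr => k _; rewrite mulrBl mul1r.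
have := series_tail_le (v := fun k => k%:R ^+ 2 * p k / N%:R) (N := N) (B := C / N%:R) lim0.
rewrite subrr sub0r normrN; apply.
- move=> k Nk; rewrite normrM [`|p k|]ger0_norm // mulrAC ler_wpM2r //.
  have k1 : 1 <= k%:R :> K by rewrite ler1n (leq_trans N0).
  have Nk' : N%:R <= k%:R :> K by rewrite ler_nat.
  by rewrite ger0_norm ?subr_ge0 // ler_pdivlMr //; nra.
- by move=> k; rewrite divr_ge0 ?mulr_ge0 ?exprn_ge0.
- by move=> m; rewrite -mulr_suml ler_wpM2r ?invr_ge0.
Unshelve. all: by end_near. Qed.

Let F_moment2 N : moment2 1 (F N) <= C + 1.
Proof.
rewrite (moment2E _ (size_poly _ _)).
apply: le_trans (lerD (p_second N) (F_le1 N)).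
rewrite F_horner1 -big_split /=; apply: ler_sum => k _.
rewrite coef_poly ltn_ord; have k0 : 0 <= k%:R :> K by [].
have := p_ge0 k; nra.
Qed.

(** The bias of the truncated law is at most C / N per summand, so it
contributes C^2 only. *)
Lemma moment2_sum_le N : (0 < N)%N ->
  moment2 N%:R (F N ^+ N) <= (C + 1 + C ^+ 2) * N%:R.
Proof.
move=> N0; have NR : 1 <= N%:R :> K by rewrite ler1n.
have := moment2_exp_le 1 N (F_ge0 N) (F_le1 N); rewrite mulr1 => /le_trans; apply.
have m1 : (N%:R * moment1 1 (F N)) ^+ 2 <= C ^+ 2.
  rewrite -[leLHS]real_normK ?num_real // lerXn2r ?nnegrE //.
  rewrite normrM [`|N%:R|]ger0_norm // mulrC -ler_pdivlMr; first exact: F_moment1.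
  by rewrite (lt_le_trans ltr01).
have := F_moment2 N; have := sqr_ge0 C; nra.
Qed.

Lemma total_mass_ge N : (0 < N)%N -> 4 * C <= N%:R -> 3 / 4 <= (F N).[1] ^+ N.
Proof.
move=> N0 N4C; have NR : 0 < N%:R :> K by rewrite ltr0n.
apply: le_trans (bernoulli_expr_ge _ (horner_nneg_ge0 (F_ge0 N) (@ler01 K)) (F_le1 N)).
have : N%:R * (1 - (F N).[1]) <= 4^-1.
  apply: le_trans (ler_wpM2l (ltW NR) (F_defect N0)) _.
  have -> : N%:R * (C / N%:R ^+ 2) = C / N%:R.
    by rewrite mulrCA expr2 invfM mulVKf ?gt_eqF.
  by rewrite ler_pdivrMr //; lra.
lra.
Qed.

(** Weak form of the local limit theorem at distance 1 from the mean: the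
coefficient is the probability that n + 1 independent variables of law p, of
mean 1, have sum n. *)
Lemma local_limit_bounds : exists c c' : K, [/\ 0 < c, 0 < c' &
  \forall n \near \oo, c / Num.sqrt n.+1%:R <= fps_exp p n.+1 n <=
    c' / Num.sqrt n.+1%:R].
Proof.
have [m [q [m_gt0 pmq]]] := aperiodic_power_consecutive p_ge0 p0_gt0 p_gcd.
pose e i := fps_exp p m (q + i).
pose eps := Num.min (e 0%N) (Num.min (e 1%N) (e 2%N)).
have eps_gt0 : 0 < eps by rewrite !lt_min !pmq.
have eps_le i : (i <= 2)%N -> eps <= e i.
  by case: i => [|[|[|//]]] _; rewrite !ge_min lexx ?orbT.
pose V : {poly K} := 'X^q * two_coins K.
(* V_i vanishes unless i = q, q + 1 or q + 2, where it is at most 1. *)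
have V_le i : eps * V`_i <= ((F (q + 3).+1) ^+ m)`_i.
  have F0 := nneg_coef_exp m (F_ge0 (q + 3).+1) i.
  rewrite coefXnM; case: ltnP => qi; first by rewrite mulr0.
  have := coef_two_coins_exp K 1 (i - q); rewrite !expr1 => ->.
  have [i2|i2] := leqP (i - q) 2; last by rewrite bin_small // mul0r mulr0.
  have := eps_le _ i2; rewrite /e subnKC // (@fps_exp_coef _ _ _ _ (q + 3).+1); last by lia.
  apply: le_trans; rewrite ler_piMr ?(ltW eps_gt0) // ler_pdivrMr // mul1r ler_nat.
  by move: (i - q)%N i2 => [|[|[|]]].
have V_leF N i : (q + 3 < N)%N -> eps * V`_i <= ((F N) ^+ m)`_i.
  move=> qN; apply: le_trans (V_le i) _; apply: coef_exp_le => // j.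
  rewrite !coef_poly; case: ltnP => // jq; last by case: ifP.
  by rewrite (leq_trans jq).
pose H N := F N ^+ m - eps *: V.
have H_ge0 N : (q + 3 < N)%N -> nneg_coef (H N).
  by move=> qN i; rewrite coefB coefZ subr_ge0 V_leF.
have FE N : F N ^+ m = H N + eps *: V by rewrite subrK.
(* With N = n + 1: the second moment of the sum about N is at most W0 N; when k
   is not too small, k >= c4 N; when x^2 < 4 W0 N, (x + 1)^2 <= B N. These give
   4 (x + 1)^2 <= A k, the window of [two_coins_exp_lower]. *)
pose W0 := C + 1 + C ^+ 2.
pose c4 := eps / (8 * m%:R).
pose B := 8 * W0 + 2.
pose A := 4 * B / c4.
have W0_gt0 : 0 < W0 by have := sqr_ge0 C; rewrite /W0; have := C_ge0; lra.
have mR : 1 <= m%:R :> K by rewrite ler1n.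
have mR0 : 0 < m%:R :> K by rewrite ltr0n.
have c4_gt0 : 0 < c4 by rewrite divr_gt0 // mulr_gt0.
have B_gt0 : 0 < B by rewrite /B; lra.
exists (expR (- A) / 8), (2^-1 * (eps^-1 + 1) * Num.sqrt m%:R).
split.
- by rewrite divr_gt0 ?expR_gt0.
- by rewrite !mulr_gt0 ?addr_gt0 ?invr_gt0 ?sqrtr_gt0.
near=> n; set N := n.+1.
have qN : (q + 3 < N)%N by rewrite ltnS; near: n; exact: nbhs_infty_ge.
have Nge (x : K) : x <= n%:R -> x <= N%:R by move=> /le_trans; apply; rewrite ler_nat.
have N4C : 4 * C <= N%:R by apply: Nge; near: n; exact: nbhs_infty_ger.
have Nc4 : c4^-1 <= N%:R by apply: Nge; near: n; exact: nbhs_infty_ger.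
have NB : 16 * B / c4 ^+ 2 <= N%:R by apply: Nge; near: n; exact: nbhs_infty_ger.
have N0 : (0 < N)%N by [].
have NR : 0 < N%:R :> K by rewrite ltr0n.
have sN : 0 < Num.sqrt N%:R :> K by rewrite sqrtr_gt0.
pose M := (N %/ m)%N; pose s := (N %% m)%N.
have NE : (m * M + s = N)%N by rewrite mulnC -divn_eq.
have NM : (N <= m * M.+1)%N by rewrite mulnC ltnW // ltn_ceil.
have MN : (M <= N)%N by exact: leq_div.
have MR : 0 < M.+1%:R :> K by rewrite ltr0n.
have NMR : N%:R <= m%:R * M.+1%:R :> K by rewrite -natrM ler_nat.
have -> : fps_exp p N n = (F N ^+ N)`_n by exact: fps_exp_coef.
apply/andP; split; last first.
  have := mixture_coef_upper (F_ge0 N) (F_le1 N) (H_ge0 N qN) eps_gt0 (FE N) M s n.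
  rewrite NE => /le_trans; apply.
  rewrite -[leRHS]mulrA ler_wpM2l //.
    by rewrite mulr_ge0 // addr_ge0 // invr_ge0 ltW.
  rewrite ler_pdivlMr // mulrC ler_pdivrMr ?sqrtr_gt0 // -sqrtrM ?(ltW mR0) //.
  exact: ler_wsqrtr.
pose D := expR (- A) / (2 * Num.sqrt N%:R).
have D0 : 0 <= D by rewrite divr_ge0 ?expR_ge0 // mulr_ge0 // ltW.
pose k0 := M.+1%:R * eps / 4.
have Me : 0 < M.+1%:R * eps by rewrite mulr_gt0.
have k0_ge0 : 0 <= k0 by rewrite divr_ge0 // ltW.
rewrite (_ : _ / _ = D / 4); last by rewrite /D; field; rewrite gt_eqF.
have -> : (F N ^+ N)`_n = (F N ^+ (m * M + s))`_n by rewrite NE.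
have W_gt0 : 0 < 4 * W0 * N%:R by rewrite !mulr_gt0.
apply: (mixture_coef_lower (F_ge0 N) (F_le1 N) (H_ge0 N qN) eps_gt0 (FE N)
  (k0 := k0) (W := 4 * W0 * N%:R)) => //.
- by rewrite /k0 le_eqVlt; apply/predU1P; left; field; rewrite ?gt_eqF.
- rewrite NE (le_trans (moment2_sum_le N0)) // le_eqVlt; apply/predU1P; left.
  by rewrite /W0; field.
- by rewrite NE; exact: total_mass_ge.
move=> k w kM; rewrite NE.
set x := w%:R - _; set rhs := if _ then _ else _.
have rhs_ge0 : 0 <= rhs.
  rewrite /rhs; case: ifP => // _; rewrite exprMn -exprM coefXnM.
  by case: ifP => // _; rewrite coef_two_coins_exp divr_ge0 // exprn_ge0.
have k1 : 0 < k.+1%:R :> K by rewrite ltr0n.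
set al := k0 / k.+1%:R; set be := x ^+ 2 / (4 * W0 * N%:R).
have a_ge0 : 0 <= al by rewrite divr_ge0 // ltW.
have b_ge0 : 0 <= be by rewrite divr_ge0 ?sqr_ge0 // ltW.
(* In the two unlikely cases the lower bound is nonpositive. *)
have [a1|a1] := leP 1 al.
  by apply: le_trans rhs_ge0; rewrite mulr_ge0_le0 //; lra.
have [b1|b1] := leP 1 be.
  by apply: le_trans rhs_ge0; rewrite mulr_ge0_le0 //; lra.
apply: (@le_trans _ _ D); first by rewrite ler_piMr //; lra.
move: a1; rewrite ltr_pdivrMr // mul1r => a1.
move: b1; rewrite ltr_pdivrMr // mul1r => b1.
have kc4 : c4 * N%:R <= k%:R.
  have c4N : 1 <= c4 * N%:R by rewrite mulrC -ler_pdivrMr // mul1r.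
  have k0N : 2 * (c4 * N%:R) <= k0.
    rewrite /k0 /c4 (_ : 2 * _ = eps / 4 * (N%:R / m%:R)); last by field; rewrite gt_eqF.
    rewrite (_ : M.+1%:R * eps / 4 = eps / 4 * M.+1%:R); last by ring.
    by rewrite ler_wpM2l ?divr_ge0 ?(ltW eps_gt0) // ler_pdivrMr // mulrC.
  rewrite -(lerD2r 1) natr1; apply: le_trans (ltW a1).
  by rewrite (le_trans _ k0N) // mulr_natl mulr2n lerD2l.
have kR : 0 < k%:R :> K by apply: lt_le_trans kc4; rewrite mulr_gt0.
have k_gt0 : (0 < k)%N by rewrite -(ltr0n K).
have x1B : (x + 1) ^+ 2 <= B * N%:R.
  have : 1 <= N%:R :> K by rewrite ler1n.
  have := sqr_ge0 (x - 1); rewrite /B; nra.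
have x1k : 4 * `|x + 1| <= k%:R.
  rewrite -(@ler_pXn2r _ 2) ?nnegrE ?mulr_ge0 // exprMn real_normK ?num_real //.
  apply: (@le_trans _ _ ((c4 * N%:R) ^+ 2)); last by rewrite lerXn2r ?nnegrE ?mulr_ge0 // ltW.
  move: NB; rewrite ler_pdivrMr ?exprn_gt0 // => NB; nra.
have x1A : 4 * (x + 1) ^+ 2 <= A * k%:R.
  rewrite /A mulrAC ler_pdivlMr //.
  apply: (@le_trans _ _ (4 * (B * N%:R) * c4)).
    by rewrite ler_wpM2r ?(ltW c4_gt0) // ler_wpM2l.
  rewrite [leLHS](_ : _ = 4 * B * (c4 * N%:R)); last by ring.
  by rewrite ler_wpM2l // mulr_ge0 // ltW.
(* The target is n = N - 1, whence the shift from x to x + 1. *)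
have wqkE : (w + q * k)%:R = n%:R + (x + 1) - k%:R :> K.
  by rewrite /x /N -[n.+1%:R]natr1 natrD natrM; ring.
have wqk : (w + q * k <= n)%N.
  rewrite -(ler_nat K) wqkE -addrA gerDl subr_le0 (le_trans (ler_norm _)) //.
  by apply: le_trans x1k; rewrite ler_peMl // ler1n.
have wn : (w <= n)%N by exact: leq_trans (leq_addr _ _) wqk.
have qk : (q * k <= n - w)%N by rewrite -(leq_add2l w) subnKC.
rewrite /rhs wn exprMn -exprM coefXnM ltnNge qk /=.
apply: (@le_trans _ _ (expR (- A) / (2 * Num.sqrt k%:R))).
  rewrite /D ler_wpM2l ?expR_ge0 // lef_pV2 ?posrE ?mulr_gt0 ?sqrtr_gt0 //.
  by rewrite ler_wpM2l // ler_wsqrtr // ler_nat (leq_trans kM).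
have jk : (n - w - q * k)%:R - k%:R = - (x + 1) :> K.
  by rewrite -subnDA natrB // wqkE; ring.
by apply: two_coins_exp_lower; rewrite // jk ?normrN ?sqrrN.
Unshelve. all: by end_near. Qed.

End Local_limit.

(** * Conclusion *)

(** Exponential tilting: relates the powers of the law p to those of A. *)
Lemma fps_exp_tilt (A : comNzRingType) (u : nat -> A) (c t : A) (m n : nat) :
  fps_exp (fun k => c * (u k * t ^+ k)) m n = c ^+ m * t ^+ n * fps_exp u m n.
Proof.
elim: m n => [|m IHm] n.
  by rewrite /fps_exp /= /fps_one; case: n => [|n]; rewrite ?mulr0 // !mulr1.
rewrite /fps_exp !iterS -!/(fps_exp _ m) /fps_mul mulr_sumr.
apply: eq_bigr => -[k /= kn] _; rewrite IHm exprS.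
have -> : t ^+ n = t ^+ k * t ^+ (n - k) by rewrite -exprD subnKC.
by ring.
Qed.

Lemma powR_3half (K : realType) (n : nat) : (0 < n)%N ->
  n%:R `^ (- (3 / 2)) = (n%:R * Num.sqrt n%:R)^-1 :> K.
Proof.
move=> n0; have nR : 0 < n%:R :> K by rewrite ltr0n.
rewrite powRN; congr (_^-1).
rewrite (_ : 3 / 2 = 1 + 2^-1); last by field.
by rewrite powRD ?gt_eqF ?implybT // powRr1 ?(ltW nR) // powR12_sqrt // ltW.
Qed.

Theorem theorem1p4 (K : realType) (a b : nat -> K) (R r : \bar K)
  (ha0 : a 0%N = 1) (hb0 : b 0%N = 1)
  (hR : R = conv_radius a) (hr : r = conv_radius b)
  (hR0 : (0 < R)%E) (hr0 : (0 < r)%E)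
  (hBA : forall n : nat, b n = fps_comp a (fps_mul (fps_X K) b) n)
  (ha : forall n : nat, (1 <= n)%N -> 0 <= a n)
  (hgcd : is_gcd_set [set n : nat | (1 <= n)%N /\ 0 < a n] 1)
  (hTheta : ~ is_Theta (fun n : nat => ((b n)%:E * r ^+ n)%E)
                       (fun n : nat => (n%:R `^ (- (3 / 2)))%:E)) :
  R = (r * \sum_(0 <= n <oo) (b n)%:E * r ^+ n)%E.
Proof.
have a_ge0 n : 0 <= a n by case: n => [|n]; [rewrite ha0 | exact: ha].
apply: contrapT; rewrite hR => neq; apply: hTheta.
have [r0 [t [rE r0_gt0 t_gt0 t_lt [tE t_min]]]] :=
  critical_point a_ge0 ha0 hb0 hBA hr hr0 neq.
have h_gt0 : 0 < r0 / t by rewrite divr_gt0.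
pose p k := r0 / t * (a k * t ^+ k).
have p_ge0 k : 0 <= p k.
  by rewrite mulr_ge0 ?(ltW h_gt0) // mulr_ge0 // exprn_ge0 // ltW.
have p_gt0E k : (0 < p k) = (0 < a k).
  by rewrite pmulr_rgt0 // pmulr_lgt0 // exprn_gt0.
have p_gcd : is_gcd_set [set n | (1 <= n)%N /\ 0 < p n] 1.
  rewrite (_ : [set _ | _] = [set n : nat | (1 <= n)%N /\ 0 < a n]) //.
  by apply/seteqP; split => n /=; rewrite p_gt0E.
have p0_gt0 : 0 < p 0%N by rewrite p_gt0E ha0.
have [C p_second] := critical_second_moment a_ge0 r0_gt0 t_gt0 t_lt.
have [c [c' [c_gt0 c'_gt0 bounds]]] := local_limit_bounds p_ge0 p0_gt0 p_gcd
  (critical_total t_gt0 t_lt tE)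
  (critical_mean a_ge0 t_gt0 t_lt tE t_min) p_second.
have bE n : b n * r0 ^+ n = t / r0 * fps_exp p n.+1 n / n.+1%:R.
  rewrite /p fps_exp_tilt -(lagrange_inversion hBA) exprSr expr_div_n.
  by field; rewrite nat1r pnatr_eq0 expf_eq0 !gt_eqF // andbF.
have tr_gt0 : 0 < t / r0 by rewrite divr_gt0.
exists (t / r0 * c / 4), (t / r0 * c / 4 + t / r0 * c'); split.
- by rewrite divr_gt0 // mulr_gt0.
- by rewrite lerDl mulr_ge0 // ltW.
near=> n; have n_gt0 : (0 < n)%N by near: n; exact: nbhs_infty_gt.
have /andP[low up] : c / Num.sqrt n.+1%:R <= fps_exp p n.+1 n <=
    c' / Num.sqrt n.+1%:R by near: n.
have nR : 1 <= n%:R :> K by rewrite ler1n.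
have nR0 : 0 < n%:R :> K by rewrite ltr0n.
pose v m : K := m%:R * Num.sqrt m%:R.
have v_gt0 : 0 < v n by rewrite mulr_gt0 ?sqrtr_gt0.
have v1_gt0 : 0 < v n.+1 by rewrite mulr_gt0 ?sqrtr_gt0.
have v_le : v n <= v n.+1.
  by apply: ler_pM; rewrite ?sqrtr_ge0 ?ler_wsqrtr ?ler_nat.
have v_ge : v n.+1 <= 4 * v n.
  rewrite /v (_ : 4 * _ = (2 * n%:R) * (2 * Num.sqrt n%:R)); last by ring.
  apply: ler_pM; rewrite ?sqrtr_ge0 //; first by rewrite -natr1; lra.
  have -> : 2 * Num.sqrt n%:R = Num.sqrt (2 ^+ 2 * n%:R) :> K.
    by rewrite sqrtrM ?sqr_ge0 // sqrtr_sqr ger0_norm.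
  by rewrite ler_wsqrtr // -natr1; lra.
have vE x : x / Num.sqrt n.+1%:R / n.+1%:R = x / v n.+1 by rewrite /v invfM mulrA mulrAC.
have {}low : c / v n.+1 <= fps_exp p n.+1 n / n.+1%:R by rewrite -vE ler_wpM2r.
have {}up : fps_exp p n.+1 n / n.+1%:R <= c' / v n.+1 by rewrite -vE ler_wpM2r.
rewrite rE -EFin_expe -!EFinM !lee_fin powR_3half // -/(v n) bE.
have low' : c / 4 / v n <= fps_exp p n.+1 n / n.+1%:R.
  apply: le_trans low; rewrite -mulrA -invfM ler_wpM2l ?(ltW c_gt0) //.
  by rewrite lef_pV2 ?posrE // mulr_gt0.
have up' : fps_exp p n.+1 n / n.+1%:R <= c' / v n.
  by apply: le_trans up _; rewrite ler_wpM2l ?(ltW c'_gt0) // lef_pV2 ?posrE.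
split; first by have := ler_wpM2l (ltW tr_gt0) low'; rewrite !mulrA.
have := ler_wpM2l (ltW tr_gt0) up'; rewrite !mulrA => /le_trans; apply.
rewrite ler_wpM2r ?invr_ge0 ?(ltW v_gt0) // lerDr.
by rewrite divr_ge0 // mulr_ge0 // ltW.
Unshelve. all: by end_near. Qed.
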